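(* Let $n$ be a positive integer, let $F$ be any field, let $\lambda$ be a partition of $n$ whose parts have exactly $m$ different nonzero lengths, and let $S^\lambda$ be the corresponding Specht module over $F\Sigma_n$. Then the minimal polynomial of $E_{n-1}$ acting on the restriction $S^\lambda\downarrow_{\Sigma_{n-1}}$ is \[ \prod_{u=1}^m\bigl(x-E(\lambda{\downarrow_u})\bigr), \] while the minimal polynomial of $E_{n+1}$ acting on the induced module $S^\lambda\uparrow^{\Sigma_{n+1}}$ is \[ \prod_{u=1}^{m+1}\bigl(x-E(\lambda{\uparrow^u})\bigr). \]
   Context: $\Sigma_k$ is the symmetric group on $\{1,\ldots,k\}$; $\Sigma_{n-1}\subset\Sigma_n\subset\Sigma_{n+1}$. Modules are right modules. $E_k\in F\Sigma_k$ is the sum of all transpositions in $\Sigma_k$. For a partition $\mu$, $E(\mu)\in F$ is the sum over all nodes $(r,c)$ ($r$-th row, $c$-th column) of the Young diagram $[\mu]$ of the residues $(c-r)1_F$. Let $(r_1,c_1),\ldots,(r_m,c_m)$ be the removable nodes of $[\lambda]$, ordered so that $r_1<\cdots<r_m$ and $c_1>\cdots>c_m$, and set $r_0=0=c_{m+1}$. For $1\le u\le m$, $\lambda{\downarrow_u}$ is the partition of $n-1$ obtained by decreasing the $r_u$-th part of $\lambda$ by $1$. The addable nodes of $[\lambda]$ are $(r_{u-1}+1,c_u+1)$ for $1\le u\le m+1$, and $\lambda{\uparrow^u}$ is the partition of $n+1$ obtained by increasing the $(r_{u-1}+1)$-th part of $\lambda$ by $1$ (for $u=m+1$ this means appending a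 new part equal to $1$). The Specht module follows the conventions of James: a $\lambda$-tableau is a bijection $t$ from the Young diagram $[\lambda]$ (rows numbered top to bottom, columns left to right) to $\{1,\ldots,n\}$, with $\pi\in\Sigma_n$ acting by $(t\pi)_{rc}=(t_{rc})\pi$ (permutations act on the right); the $\lambda$-tabloid $\{t\}$ is the ordered set partition of $\{1,\ldots,n\}$ whose $u$-th part is the set of entries in the $u$-th row of $t$; $M^\lambda$ is the $F$-vector space with basis the $\lambda$-tabloids and action $\{t\}\pi=\{t\pi\}$; $C_t$ is the column stabilizer of $t$; $e_t=\sum_{\pi\in C_t}\operatorname{sgn}(\pi)\{t\pi\}$; and $S^\lambda$ is the $F\Sigma_n$-submodule of $M^\lambda$ spanned by all $e_t$. *)

(* Defs.v *)
From HB Require Import structures.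
From mathcomp Require Import all_boot all_order all_algebra.
From mathcomp Require Import all_fingroup all_solvable all_field all_character.

Set Implicit Arguments.
Unset Strict Implicit.
Unset Printing Implicit Defensive.

Import GroupScope GRing.Theory.
Local Open Scope ring_scope.

(** * Partitions and Young diagrams *)

Definition is_partition_of (n : nat) (la : seq nat) : bool :=
  [&& sorted geq la, 0%N \notin la & sumn la == n].

(* Rows and columns of nodes are numbered from 0; residues col - row are
   unaffected by this shift. *)
Definition node (la : seq nat) : finType := {r : 'I_(size la) & 'I_(nth 0%N la r)}.
Definition node_row la (x : node la) : nat := tag x.
Definition node_col la (x : node la) : nat := tagged x.

(* The sum E(mu) of the residues. *)
Definition residue_sum (F : fieldType) (mu : seq nat) : F :=
  \sum_(x : node mu) ((node_col x)%:R - (node_row x)%:R).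

(* [corner_row la u] is r_u for 1 <= u <= m, where r_1 < ... < r_m are the rows,
   numbered from 1, of the removable nodes of la; moreover r_0 = 0. *)
Definition corner_row (la : seq nat) (u : nat) : nat :=
  nth 0%N (0%N :: [seq r <- iota 1 (size la) | (nth 0 la r < nth 0 la r.-1)%N]) u.

(* Part number r in the 1-based numbering has index r.-1 in the sequence la. *)
Definition part_down (la : seq nat) (u : nat) : seq nat :=
  let i := (corner_row la u).-1 in
  [seq p <- set_nth 0%N la i (nth 0%N la i).-1 | p != 0%N].

(* Part number r_(u-1) + 1 has index r_(u-1); [incr_nth] appends a new part 1
   when this index is [size la]. *)
Definition part_up (la : seq nat) (u : nat) : seq nat :=
  incr_nth la (corner_row la u.-1).

(** * Minimal polynomials *)

(* [mxminpoly] is only available in dimension d.+1; every polynomial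
   annihilates the zero module, so its minimal polynomial is 1. *)
Definition minpoly_mx (F : fieldType) (d : nat) : 'M[F]_d -> {poly F} :=
  if d is d'.+1 return 'M[F]_d -> {poly F} then fun A => mxminpoly A
  else fun=> 1.

(** * Symmetric groups *)

Lemma sym_incl_morphM (n : nat) :
  {in [set: 'S_n] &, {morph @lift_perm n ord_max ord_max : s t / (s * t)%g}}.
Proof. by move=> s t _ _ /=; rewrite lift_permM. Qed.

(* The inclusion of S_n in S_n.+1 as the stabilizer of the last point. *)
Canonical sym_incl (n : nat) : {morphism [set: 'S_n] >-> 'S_n.+1} :=
  Morphism (@sym_incl_morphM n).

Definition transpositions (k : nat) : {set 'S_k} :=
  [set tperm p.1 p.2 | p in [set p : 'I_k * 'I_k | p.1 != p.2]].

Definition E_elt (F : fieldType) (k : nat) : 'M[F]_#|[set: 'S_k]| :=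
  gset_mx F [set: 'S_k]%G (transpositions k).

(** * Tableaux, tabloids and Specht modules *)

Definition is_tableau n la (t : {ffun node la -> 'I_n}) : bool :=
  injectiveb t && [forall i, i \in codom t].

Definition tableau (n : nat) (la : seq nat) : finType :=
  {t : {ffun node la -> 'I_n} | is_tableau t}.

Section Tableaux.

Variables (n : nat) (la : seq nat).
Implicit Types (t : tableau n la) (s : 'S_n).

Fact tableau_act_proof t s : is_tableau [ffun x => s (val t x)].
Proof.
case: t => t /= /andP[/injectiveP t_inj /forallP t_surj]; apply/andP; split.
  by apply/injectiveP=> x y; rewrite !ffunE => /perm_inj/t_inj.
apply/forallP=> i; have /codomP[x def_i] := t_surj (s^-1%g i).
by apply/codomP; exists x; rewrite ffunE -def_i permKV.
Qed.

Definition tableau_act t s : tableau n la := Sub _ (tableau_act_proof t s).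

Definition row_sets t : {ffun 'I_(size la) -> {set 'I_n}} :=
  [ffun u : 'I_(size la) => [set val t x | x : node la & tag x == u]].

Definition is_tabloid (T : {ffun 'I_(size la) -> {set 'I_n}}) : bool :=
  [exists t, T == row_sets t].

Definition tabloid : finType :=
  {T : {ffun 'I_(size la) -> {set 'I_n}} | is_tabloid T}.

Fact tabloid_of_proof t : is_tabloid (row_sets t).
Proof. by apply/existsP; exists t. Qed.

Definition tabloid_of t : tabloid := Sub _ (tabloid_of_proof t).

Lemma row_sets_act t s :
  [ffun u => s @: row_sets t u] = row_sets (tableau_act t s).
Proof.
apply/ffunP=> u; rewrite !ffunE -imset_comp.
by apply: eq_imset => x; rewrite /= ffunE.
Qed.

Fact tabloid_act_proof (T : tabloid) s :
  is_tabloid [ffun u => s @: val T u].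
Proof.
case: T => T /= /existsP[t /eqP->]; apply/existsP.
by exists (tableau_act t s); rewrite row_sets_act.
Qed.

Definition tabloid_act (T : tabloid) s : tabloid :=
  Sub _ (tabloid_act_proof T s).

Lemma tabloid_act_of t s :
  tabloid_act (tabloid_of t) s = tabloid_of (tableau_act t s).
Proof. by apply: val_inj; rewrite /= row_sets_act. Qed.

Lemma tabloid_act1 T : tabloid_act T 1%g = T.
Proof.
apply: val_inj; apply/ffunP=> u; rewrite ffunE.
by rewrite -[RHS]imset_id; apply: eq_imset => i; rewrite perm1.
Qed.

Lemma tabloid_actM T s s' :
  tabloid_act T (s * s')%g = tabloid_act (tabloid_act T s) s'.
Proof.
apply: val_inj; apply/ffunP=> u; rewrite !ffunE -imset_comp.
by apply: eq_imset => i; rewrite /= permM.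
Qed.

Lemma tableau_actM t s s' :
  tableau_act t (s * s')%g = tableau_act (tableau_act t s) s'.
Proof. by apply: val_inj; apply/ffunP=> x; rewrite !ffunE permM. Qed.

Definition column_stab t : {set 'S_n} :=
  [set s : 'S_n | [forall x : node la,
     [exists y : node la,
        (node_col y == node_col x) && (s (val t x) == val t y)]]].

Lemma column_stab_act t s :
  column_stab (tableau_act t s) = (column_stab t :^ s)%g.
Proof.
apply/setP=> p; rewrite mem_conjg !inE; apply: eq_forallb => x.
apply: eq_existsb => y; congr (_ && _).
by rewrite !ffunE conjgE invgK !permM (can2_eq (permKV s) (permK s)).
Qed.

Variable F : fieldType.

Definition tabloid_vec (T : tabloid) : 'rV[F]_#|tabloid| :=
  delta_mx 0 (enum_rank T).

Definition tabloid_mx s : 'M[F]_#|tabloid| :=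
  \matrix_i tabloid_vec (tabloid_act (enum_val i) s).

Lemma tabloid_vec_act T s : tabloid_vec T *m tabloid_mx s = tabloid_vec (tabloid_act T s).
Proof. by rewrite -rowE rowK enum_rankK. Qed.

Lemma tabloid_mx_repr : mx_repr [set: 'S_n] tabloid_mx.
Proof.
split=> [|s s' _ _]; apply/row_matrixP=> i.
  by rewrite rowK tabloid_act1 row1 /tabloid_vec enum_valK.
by rewrite row_mul !rowK tabloid_vec_act tabloid_actM.
Qed.

(* The permutation module M^la. *)
Definition tabloid_repr : mx_representation F [set: 'S_n] #|tabloid| :=
  MxRepresentation tabloid_mx_repr.

Definition polytabloid t : 'rV[F]_#|tabloid| :=
  \sum_(s in column_stab t) (-1) ^+ s *: tabloid_vec (tabloid_of (tableau_act t s)).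

Lemma polytabloid_act t s :
  polytabloid t *m tabloid_mx s = polytabloid (tableau_act t s).
Proof.
rewrite /polytabloid column_stab_act mulmx_suml.
rewrite [RHS](reindex_inj (conjg_inj s)) /=.
apply: eq_big => [p|p _]; first by rewrite memJ_conjg.
rewrite -scalemxAl tabloid_vec_act tabloid_act_of -!tableau_actM.
by rewrite odd_permJ -conjgC.
Qed.

Definition specht_mx : 'M[F]_#|tabloid| := (\sum_t <<polytabloid t>>)%MS.

Lemma specht_module : mxmodule tabloid_repr specht_mx.
Proof.
apply/mxmoduleP=> s _; rewrite sumsmxMr; apply/sumsmx_subP=> t _.
rewrite (eqmxMr _ (genmxE _)) /= polytabloid_act.
by rewrite (sumsmx_sup (tableau_act t s)) // genmxE.
Qed.

Definition specht_repr : mx_representation F [set: 'S_n] (\rank specht_mx) :=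
  submod_repr specht_module.

End Tableaux.

(** * Restriction from S_n.+1 to S_n *)

Fact sym_incl_sub (n : nat) :
  [set: 'S_n] \subset (sym_incl n @*^-1 [set: 'S_n.+1])%g.
Proof. by apply/subsetP=> s _; rewrite !inE. Qed.

Definition res_repr (F : fieldType) (n d : nat)
    (rG : mx_representation F [set: 'S_n.+1] d) :
    mx_representation F [set: 'S_n] d :=
  subg_repr (morphpre_repr (sym_incl n) rG) (sym_incl_sub n).

(** * Induction along a group morphism *)

Section Induction.

Variables (F : fieldType) (aT rT : finGroupType) (H : {group aT}).
Variables (f : {morphism H >-> rT}) (d : nat) (rH : mx_representation F H d).

Local Notation G := [set: rT]%G.
Local Notation nG := #|[set: rT]|.
Local Notation aG := (regular_repr F G).

(* The space V (x)_F FG is 'M_(d, nG), flattened by [mxvec]: the tensor v (x) g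
   is v^T *m delta_mx 0 (gring_index G g). *)
Definition tensor_mx (x : rT) : 'M[F]_(d * nG) := lin_mulmxr (aG x).

Lemma tensor_mx_repr : mx_repr G tensor_mx.
Proof.
split=> [|x y Gx Gy]; apply/row_matrixP=> i; apply/eqP.
  rewrite rowE mul_rV_lin /= repr_mx1 mulmx1 vec_mxK row1.
  by [].
rewrite !rowE mulmxA !mul_rV_lin /= mxvecK repr_mxM //.
by rewrite mulmxA.
Qed.

Definition tensor_repr : mx_representation F G (d * nG) :=
  MxRepresentation tensor_mx_repr.

(* Left multiplication by x on FG: the basis vector of g goes to that of xg. *)
Definition left_regular_mx (x : rT) : 'M[F]_nG :=
  \matrix_i delta_mx 0 (gring_index G (x * enum_val i)%g).

Lemma left_regular_comm x y : left_regular_mx x *m aG y = aG y *m left_regular_mx x.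
Proof.
apply/row_matrixP=> i; rewrite !row_mul !rowK -!rowE !rowK.
by rewrite !gring_indexK ?inE // mulgA.
Qed.

(* The row space is spanned by all vh (x) g - v (x) f(h)g. *)
Definition tensor_rel_mx : 'M[F]_(d * nG) :=
  (\sum_(h in H) (lin_mulmx (rH h)^T - lin_mulmxr (left_regular_mx (f h))))%MS.

Lemma tensor_rel_module : mxmodule tensor_repr tensor_rel_mx.
Proof.
apply/mxmoduleP=> x Gx; rewrite sumsmxMr; apply/sumsmx_subP=> h Hh.
apply: (sumsmx_sup h) => //=.
suffices ->: (lin_mulmx (rH h)^T - lin_mulmxr (left_regular_mx (f h)))
    *m tensor_mx x
  = tensor_mx x *m (lin_mulmx (rH h)^T - lin_mulmxr (left_regular_mx (f h))).
  exact: submxMl.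
apply/row_matrixP=> i; rewrite !rowE !mulmxA mulmxBr mulmxBl mulmxBr.
rewrite !mul_rV_lin /= !mxvecK; congr (mxvec _ - mxvec _).
  by rewrite mulmxA.
by rewrite -!mulmxA left_regular_comm.
Qed.

(* V (x)_{FH} FG, where H acts on the left of FG through f. *)
Definition ind_repr : mx_representation F G (\rank (cokermx tensor_rel_mx)) :=
  factmod_repr tensor_rel_module.

End Induction.

(* Main.v *)
Require Import Defs.
From mathcomp Require Import all_boot all_order all_algebra.
From mathcomp Require Import all_fingroup all_solvable all_field all_character.
From mathcomp Require Import zify.

Set Implicit Arguments.
Unset Strict Implicit.
Unset Printing Implicit Defensive.

Import GRing.Theory.
Local Open Scope ring_scope.

(* Write e_t for a polytabloid, * for the last point and L for the sum of the
   transpositions moving *. Only two relations in the Specht module are used: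
   e_t is antisymmetric in each column, and (Garnir) exchanging an entry y in all
   ways with the entries of another column at least as tall as that of y gives
   e_t back. They show that the sum E of all transpositions acts on the Specht
   module by the sum of the residues, and that they triangularize the sum of
   transpositions in the two modules:
   - on the restriction, E_(n-1) = E_n - L, and if * lies in a column of height h
     then e_t L is e_t times the residue of the removable node in row h, plus
     polytabloids with * in shorter columns;
   - on the induced module, let d_(t,c) be e_t (x) 1 antisymmetrized over column c
     enlarged by *. If column c is the first of its height, then E acts on d_(t,c),
     modulo translates of the d_(t,c') with c' < c, by the scalar for adding a node
     at the bottom of column c; the other columns of that height are redundant.
   So the products annihilate. As their roots may coincide in F, the lower bound
   on the degree needs the vectors v, vL, vL^2, ... to be independent for a
   suitable v. Let * be at the lowest corner (or at a new node below everything).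
   Follow the tabloid obtained by swapping * with the entries of the other
   corners, from bottom to top: every such swap puts an entry below the bottom of
   its column, and k of these displaced entries need at least k swaps with *, in a
   unique way for exactly k. So this tabloid has coefficient 1 in vL^k and 0 in
   the lower powers. *)

(** * Minimal polynomials and transposition sums *)

(** Commutation carries C past p(A): v p(A) A = v A p(A) = v C p(A) = v p(A) C. *)
Lemma mulmx_horner_comm (F : fieldType) d (A C : 'M[F]_d.+1) (v : 'rV_d.+1) (p : {poly F}) :
  GRing.comm A C -> v *m A = v *m C -> v *m horner_mx A p = v *m horner_mx C p.
Proof.
move=> cAC vAC; elim/poly_ind: p => [|p c IHp]; first by rewrite !rmorph0.
rewrite !rmorphD !rmorphM /= !horner_mx_X !horner_mx_C !mulmxDr; congr (_ + _).
have cA : comm_mx (horner_mx A p) A by apply: comm_horner_mx.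
have cC : comm_mx (horner_mx A p) C by apply: comm_horner_mx.
by rewrite -!mulmxE cA mulmxA vAC -mulmxA -cC !mulmxA IHp.
Qed.

Lemma horner_mx_comp (F : fieldType) d (B : 'M[F]_d.+1) (p q : {poly F}) :
  horner_mx B (p \Po q) = horner_mx (horner_mx B q) p.
Proof.
elim/poly_ind: p => [|p c IHp]; first by rewrite comp_poly0 !rmorph0.
rewrite comp_polyD comp_polyM comp_polyX comp_polyC !rmorphD !rmorphM /=.
by rewrite IHp horner_mx_X !horner_mx_C.
Qed.

(* The unitriangular family of functionals makes the v B^k with k < size cs
   independent; on v, the matrix A acts as an affine function of B. *)
Lemma minpoly_mx_prod (F : fieldType) d (A B : 'M[F]_d) (v : 'rV_d) (a b : F) (cs : seq F) :
    (0 < size cs)%N -> GRing.comm A B -> v *m A = v *m (a%:M + b *: B) -> b != 0 ->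
    \prod_(c <- cs) (A - c%:M) = 0 ->
    (forall k, (k < size cs)%N -> exists2 f : 'cV_d, v *m B ^+ k *m f = 1%:M &
        forall j, (j < k)%N -> v *m B ^+ j *m f = 0) ->
  minpoly_mx A = \prod_(c <- cs) ('X - c%:P).
Proof.
case: d => [|d] in A B v *.
  move=> cs_gt0 _ _ _ _ /(_ 0%N cs_gt0)[f]; rewrite (flatmx0 f) mulmx0 => /matrixP/(_ 0 0).
  by rewrite !mxE => /esym/eqP; rewrite oner_eq0.
move=> _ cAB vA b0 Akill indep /=.
set P := \prod_(c <- cs) _.
have dvdP : mxminpoly A %| P.
  apply: mxminpoly_min; rewrite rmorph_prod -[RHS]Akill; apply: eq_bigr => c _.
  by rewrite rmorphB /= horner_mx_X horner_mx_C.
apply/eqP; rewrite -eqp_monic ?mxminpoly_monic ?monic_prod_XsubC //.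
rewrite -(dvdp_size_eqp dvdP) eqn_leq dvdp_leq ?monic_neq0 ?monic_prod_XsubC //=.
rewrite size_prod_XsubC; set q := mxminpoly A.
rewrite ltnNge; apply/negP => le_q.
have q0 : q != 0 by rewrite monic_neq0 // mxminpoly_monic.
(* On v the matrix A acts as r(B), so v q(A) = v (q o r)(B); since b is nonzero, the composite has
   the size of q. *)
pose r : {poly F} := a%:P + b *: 'X.
have size_r : size r = 2.
  rewrite /r addrC size_polyDl size_scale ?size_polyX //.
  by rewrite size_polyC; case: (a != 0).
have hr : horner_mx B r = a%:M + b *: B.
  by rewrite rmorphD /= horner_mxZ horner_mx_X horner_mx_C.
have cAC : GRing.comm A (horner_mx B r) by apply/comm_mx_sym/comm_horner_mx/comm_mx_sym.
rewrite -hr in vA.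
have := mulmx_horner_comm q cAC vA; rewrite mx_root_minpoly mulmx0 -horner_mx_comp.
have sqr : size (q \Po r) = size q by apply: size_comp_poly2.
have p0 : q \Po r != 0 by rewrite comp_poly2_eq0.
set p := q \Po r in sqr p0 *; rewrite -sqr in le_q.
have [s sp] : {s | size p = s.+1} by exists (size p).-1; rewrite prednK ?size_poly_gt0.
(* The functional for the degree s of p kills the lower powers and isolates the leading coefficient,
   which would then vanish. *)
have [|f f1 f0] := indep s; first by rewrite -sp.
move/esym/(congr1 (fun w => w *m f)); rewrite mul0mx -[p]coefK poly_def sp.
rewrite rmorph_sum /= mulmx_sumr mulmx_suml big_ord_recr big1 ?add0r /=; last first.
  by move=> i _; rewrite horner_mxZ rmorphXn /= horner_mx_X -scalemxAr -scalemxAl f0 ?scaler0.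
rewrite horner_mxZ rmorphXn /= horner_mx_X -scalemxAr -scalemxAl f1 scalemx1.
move/matrixP/(_ 0 0); rewrite !mxE eqxx => /eqP; rewrite mulr1n.
by have := lead_coef_eq0 p; rewrite /lead_coef sp (negPf p0) add0r /= => ->.
Qed.

(** Each transposition comes from two ordered pairs; the tournament R keeps exactly one of them. *)
Lemma big_transpositions (V : nmodType) k (R : rel 'I_k) (f : 'S_k -> V) :
    (forall i j, i != j -> R i j = ~~ R j i) -> (forall i, ~~ R i i) ->
  \sum_(s in transpositions k) f s = \sum_i \sum_(j | R i j) f (tperm i j).
Proof.
move=> Rtour Rirr; rewrite pair_big_dep /=.
have -> : transpositions k = [set tperm p.1 p.2 | p in [set p : 'I_k * 'I_k | R p.1 p.2]].
  apply/setP=> s; apply/imsetP/imsetP=> -[[i j]]; rewrite inE /= => Rij ->.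
    have [Rij'|nRij] := boolP (R i j); first by exists (i, j); rewrite ?inE.
    by exists (j, i); rewrite ?inE /= 1?tpermC // Rtour 1?eq_sym.
  by exists (i, j); rewrite // inE /=; apply: contraTneq Rij => ->.
rewrite big_imset /=; last first.
  move=> [i j] [i' j']; rewrite !inE /= => Rij Rij' /permP eq_t.
  have nij : i != j by apply: contraTneq Rij => ->.
  have := eq_t i; rewrite tpermL; case: tpermP => [-> -> //|iE jE|_ _ ji].
    by move: Rij'; rewrite -iE -jE Rtour 1?eq_sym // Rij.
  by rewrite ji eqxx in nij.
by apply: eq_bigl => -[i j]; rewrite inE.
Qed.

Lemma big_transpositions_last (V : nmodType) k (f : 'S_k.+1 -> V) :
  \sum_(s in transpositions k.+1) f s =
    \sum_(s in transpositions k) f (sym_incl k s) + \sum_(i | i != ord_max) f (tperm i ord_max).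
Proof.
rewrite (@big_transpositions _ _ (fun i j => (j < i)%N)); last 2 first.
- by move=> i j; rewrite -leqNgt ltn_neqAle eq_sym => ->.
- by move=> i; rewrite ltnn.
rewrite (@big_transpositions _ k (fun i j => (j < i)%N)); last 2 first.
- by move=> i j; rewrite -leqNgt ltn_neqAle eq_sym => ->.
- by move=> i; rewrite ltnn.
rewrite big_ord_recr /=; congr (_ + _); last first.
  apply: eq_big => i; last by rewrite tpermC.
  by rewrite ltn_neqAle -ltnS ltn_ord andbT.
apply: eq_bigr => i _; rewrite big_mkcond big_ord_recr /= ltnNge (ltnW (ltn_ord i)) addr0.
rewrite [RHS]big_mkcond /=; apply: eq_bigr => j _; case: ifP => // _; congr (f _).
have wE (l : 'I_k) : widen_ord (leqnSn k) l = lift ord_max l.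
  by apply: val_inj; rewrite /= /bump leqNgt ltn_ord.
apply/permP=> l; rewrite !wE; case: (unliftP ord_max l) => [l' ->|->].
  by rewrite lift_perm_lift (inj_tperm _ _ _ (@lift_inj _ _)).
by rewrite lift_perm_id tpermD // eq_sym neq_lift.
Qed.

Lemma prod_subC_comm (F : fieldType) d (A B : 'M[F]_d) (cs : seq F) :
  comm_mx A B -> comm_mx B (\prod_(c <- cs) (A - c%:M)).
Proof.
move=> cAB; apply: (@commr_prod _ _ _ _ _ B) => c _; apply: commrB.
  exact: comm_mx_sym.
exact: comm_mx_scalar.
Qed.

(** * Swaps with a distinguished point *)

(** The contragredient action: the coefficient of X in v s is that of [row_act X s] in v. *)
Definition row_act N (X : {ffun 'I_N -> nat}) (s : 'S_N) : {ffun 'I_N -> nat} :=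
  [ffun i => X (s i)].

Section StarWalks.

Variables (F : fieldType) (N : nat) (star : 'I_N) (rho gam : 'I_N -> nat).
Implicit Types (X : {ffun 'I_N -> nat}) (xs : seq 'I_N) (s : 'S_N).

(* The coefficient of the row assignment X in the polytabloid of the tableau with
   entry i in row rho i and column gam i; walk_coef j is its coefficient in the
   polytabloid times the j-th power of the star element. *)
Definition poly_coef X : F :=
  \sum_(s : 'S_N | [forall i, gam (s i) == gam i]) (-1) ^+ s * [forall i, X (s i) == rho i]%:R.

Fixpoint walk_coef j X : F :=
  if j is j'.+1 then \sum_(i | i != star) walk_coef j' (row_act X (tperm i star))
  else poly_coef X.

(** Entries that X puts below the bottom of their column. With [star] left out, swapping it with i
    changes the status of i alone. *)
Definition defects X : {set 'I_N} :=
  [set i | (i != star) && [forall k, (gam k == gam i) ==> (rho k < X i)%N]].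

(** The two entries avoid [star] and the defects, so that swapping [star] with a defect does not
    move them. *)
Definition collision X : bool :=
  [exists p : 'I_N * 'I_N,
    [&& p.1 != p.2, gam p.1 == gam p.2, X p.1 == X p.2,
        p.1 != star, p.2 != star, p.1 \notin defects X & p.2 \notin defects X]].

(** Along a chain each entry drops to the row of its predecessor, and [star] climbs to the row of
    the last entry. *)
Definition swap_rows xs : {ffun 'I_N -> nat} :=
  foldl (fun X x => row_act X (tperm x star)) [ffun i => rho i] xs.

Hypothesis node_inj : forall i j, rho i = rho j -> gam i = gam j -> i = j.

(** A nonzero term gives a column permutation taking the tableau to X: every row used by X then
    occurs in the column of the entry, and no row occurs twice there. *)
Lemma poly_coef_eq0 X : (0 < #|defects X| + collision X)%N -> poly_coef X = 0.
Proof.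
move=> X_bad; rewrite /poly_coef big1 // => s /forallP col_s.
case: forallP => [row_s|]; last by rewrite mulr0.
have colV i : gam (s^-1%g i) = gam i by rewrite -{2}(permKV s i) (eqP (col_s _)).
have rowV i : X i = rho (s^-1%g i) by rewrite -{1}(permKV s i) (eqP (row_s _)).
case: (set_0Vmem (defects X)) X_bad => [-> |[i]]; last first.
  rewrite inE => /andP[_ /forallP/(_ (s^-1 i)%g)].
  by rewrite colV eqxx -rowV ltnn.
rewrite cards0 add0n lt0b => /existsP[[i j] /= /and5P[nij /eqP gij /eqP Xij _ _]].
case/eqP: nij; apply: (@perm_inj _ s^-1%g).
by apply: node_inj; rewrite ?colV // -!rowV.
Qed.

Lemma defects_swap X i : defects X :\ i \subset defects (row_act X (tperm i star)).
Proof.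
apply/subsetP=> k; rewrite !inE ffunE => /and3P[ki ks /forallP kD].
by rewrite ks tpermD 1?eq_sym //; apply/forallP.
Qed.

(* A swap with star repairs at most one defect, and while it repairs one it
   leaves every collision in place. *)
Lemma walk_coef_eq0 j X : (j < #|defects X| + collision X)%N -> walk_coef j X = 0.
Proof.
elim: j X => [|j IHj] X X_bad; first exact: poly_coef_eq0.
rewrite /= big1 // => i i_star; apply: IHj.
have leD := subset_leq_card (defects_swap X i); set X' := row_act _ _ in leD *.
rewrite (cardsD1 i) in X_bad.
have [iD|niD] := boolP (i \in defects X); last first.
  (* All defects survive here, and giving up the collision costs at most 1, which the lower j pays
     for. *)
  move: X_bad; rewrite (negPf niD) add0n => X_bad.
  apply: leq_trans (leq_addr _ _); apply: leq_trans leD.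
  by move: X_bad; case: (collision X); rewrite ?addn1 ?addn0 // => /ltnW.
move: X_bad; rewrite iD add1n addSn ltnS => /leq_trans-> //.
apply: leq_add leD _; rewrite /nat_of_bool.
case collX: (collision X) => //; suff -> : collision X' by [].
case/existsP: collX => -[p q] /= /and5P[pq gpq Xpq ps /and3P[qs pD qD]].
have X'E k : k != star -> k \notin defects X -> X' k = X k.
  move=> ks kD; rewrite ffunE tpermD 1?eq_sym //.
  by apply: contraNneq kD => ->.
apply/existsP; exists (p, q); rewrite /= pq gpq !X'E // Xpq ps qs /=.
by have := qD; have := pD; rewrite !inE ps qs !X'E // => -> ->.
Qed.

(** [star] is exempt because in the induced module it occupies an isolated node. *)
Hypothesis columns_closed :
  forall i r, i != star -> (r < rho i)%N -> exists2 z, gam z = gam i & rho z = r.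

(* Row numbers increase downwards, so the entries of xs lie ever higher. *)
Definition bottom_chain xs :=
  path (fun x y => rho y < rho x)%N star xs &&
  all (fun x => [forall i, (gam i == gam x) ==> (rho i <= rho x)%N]) (star :: xs).

Let gtn_rho_trans : transitive (fun x y => rho y < rho x)%N.
Proof. by move=> y x z yx zy; apply: ltn_trans yx. Qed.

Lemma bottom_chain_rcons xs x :
  bottom_chain (rcons xs x) -> bottom_chain xs /\ (rho x < rho (last star xs))%N.
Proof.
by rewrite /bottom_chain rcons_path -rcons_cons all_rcons => /andP[/andP[-> ->] /andP[_ ->]].
Qed.

Lemma bottom_chain_uniq xs : bottom_chain xs -> uniq (star :: xs).
Proof.
by case/andP=> sxs _; apply: (@sorted_uniq _ _ gtn_rho_trans _ (star :: xs) sxs) => x; rewrite ltnn.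
Qed.

Lemma swap_rows_rcons xs x :
  swap_rows (rcons xs x) = row_act (swap_rows xs) (tperm x star).
Proof. by rewrite /swap_rows foldl_rcons. Qed.

Lemma swap_rows_out xs x : x \notin star :: xs -> swap_rows xs x = rho x.
Proof.
elim/last_ind: xs => [|xs y IHxs]; first by rewrite ffunE.
rewrite swap_rows_rcons ffunE -rcons_cons mem_rcons 2!inE !negb_or => /and3P[xy xs_ xxs].
by rewrite tpermD 1?eq_sym // IHxs // inE negb_or xs_.
Qed.

Lemma swap_rows_star xs : bottom_chain xs -> swap_rows xs star = rho (last star xs).
Proof.
case/lastP: xs => [|xs x] Cxs; first by rewrite ffunE.
rewrite swap_rows_rcons ffunE tpermR last_rcons swap_rows_out //.
by have := bottom_chain_uniq Cxs; rewrite -rcons_cons rcons_uniq => /andP[].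
Qed.

Lemma swap_rows_in xs x : bottom_chain xs -> x \in xs -> (rho x < swap_rows xs x)%N.
Proof.
elim/last_ind: xs => // xs y IHxs Cxs; have := bottom_chain_uniq Cxs.
rewrite -rcons_cons rcons_uniq => /andP[ys]; rewrite /= => /andP[star_xs _].
have [Cxs' lt_y] := bottom_chain_rcons Cxs.
rewrite swap_rows_rcons ffunE mem_rcons inE => /predU1P[->|x_xs].
  by rewrite tpermL swap_rows_star.
rewrite tpermD ?IHxs //; first by apply: contraNneq ys => ->; rewrite inE x_xs orbT.
by apply: contraNneq star_xs => ->.
Qed.

Lemma swap_rows_defects xs : bottom_chain xs -> {subset xs <= defects (swap_rows xs)}.
Proof.
move=> Cxs x x_xs; have /andP[star_xs _] := bottom_chain_uniq Cxs.
rewrite inE; apply/andP; split; first by apply: contraNneq star_xs => <-.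
have /andP[_ /allP/(_ x)] := Cxs; rewrite inE x_xs orbT => /(_ isT)/forallP bot_x.
apply/forallP=> k; apply/implyP=> gk.
by apply: leq_ltn_trans (swap_rows_in Cxs x_xs); apply: implyP (bot_x k) gk.
Qed.

Lemma walk_coef_swap_lt j xs : bottom_chain xs -> (j < size xs)%N -> walk_coef j (swap_rows xs) = 0.
Proof.
move=> Cxs lt_j; apply: walk_coef_eq0; apply: leq_trans (leq_addr _ _); apply: leq_trans lt_j _.
have /andP[_ /card_uniqP<-] := bottom_chain_uniq Cxs.
by apply: subset_leq_card; apply/subsetP; apply: swap_rows_defects.
Qed.

(** Only the identity contributes: a permutation preserving rows and columns fixes every node. *)
Lemma poly_coef_rho : poly_coef [ffun i => rho i] = 1.
Proof.
rewrite /poly_coef (bigD1 1%g) /=; last by apply/forallP=> i; rewrite perm1.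
rewrite odd_perm1 expr0 mul1r big1 ?addr0.
  by case: forallP => // -[] i; rewrite perm1 ffunE.
move=> s /andP[/forallP col_s s1]; case: forallP => [row_s|]; last by rewrite mulr0.
case/eqP: s1; apply/permP=> i; rewrite perm1.
by apply: node_inj; [have:= eqP (row_s i); rewrite ffunE | apply/eqP].
Qed.

(** The swap with the last entry x undoes the last step. Any other swap leaves too many
    obstructions: outside the chain it keeps all the defects of the chain; with an earlier entry i
    it may repair i, but creates a collision. *)
Lemma walk_coef_swap xs : bottom_chain xs -> walk_coef (size xs) (swap_rows xs) = 1.
Proof.
elim/last_ind: xs => [|xs x IHxs] Cxs; first exact: poly_coef_rho.
have [Cxs' lt_x] := bottom_chain_rcons Cxs; have Uxs := bottom_chain_uniq Cxs.
have x_star : x != star.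
  by move: Uxs; rewrite /= mem_rcons inE negb_or eq_sym => /andP[/andP[]].
rewrite size_rcons /= (bigD1 x) //= big1 ?addr0.
  have -> : row_act (swap_rows (rcons xs x)) (tperm x star) = swap_rows xs.
    by apply/ffunP=> i; rewrite swap_rows_rcons !ffunE tpermK.
  exact: IHxs.
move=> i /andP[i_star ix]; apply: walk_coef_eq0.
have := defects_swap (swap_rows (rcons xs x)) i; set Y := row_act _ _ => sDY.
have sD k : k \in rcons xs x -> k != i -> k \in defects Y.
  move=> k_xs ki; apply: (subsetP sDY); rewrite in_setD1 ki.
  exact: swap_rows_defects.
have /andP[_ Ux] := Uxs.
have [i_xs|i_nxs] := boolP (i \in rcons xs x); last first.
  apply: leq_trans (leq_addr _ _); rewrite -(size_rcons xs x) -(card_uniqP Ux).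
  apply: subset_leq_card; apply/subsetP=> k k_xs.
  by apply: sD => //; apply: contraNneq i_nxs => <-.
have szD : (size xs <= #|defects Y|)%N.
  have -> : size xs = #|[set k in rcons xs x] :\ i|.
    have := cardsD1 i [set k in rcons xs x].
    by rewrite inE i_xs cardsE (card_uniqP Ux) size_rcons => -[].
  by apply: subset_leq_card; apply/subsetP=> k /setD1P[ki]; rewrite inE => k_xs; apply: sD.
suff -> : collision Y by rewrite addn1 ltnS.
(* [star] sits in row [rho x], so the swap sends i there. That row of the column of i already holds
   an entry z, unmoved by the chain because chain entries are lowest in their columns. *)
have lt_xi : (rho x < rho i)%N.
  have := Cxs; rewrite /bottom_chain (path_sortedE gtn_rho_trans) => /andP[/andP[_]].
  rewrite -cats1 -(cat1s x) => srt _; move: i_xs; rewrite mem_rcons inE (negPf ix) /= => i_xs.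
  move: srt; rewrite (sorted_pairwise gtn_rho_trans) pairwise_cat.
  by case/and3P=> /allrelP-> //; rewrite inE.
have [z gz rz] := columns_closed i_star lt_xi.
have z_out : z \notin star :: rcons xs x.
  apply/negP=> z_in; have /andP[_ /allP/(_ z z_in)/forallP/(_ i)] := Cxs.
  by rewrite gz eqxx /= rz leqNgt lt_xi.
have zi : z != i by apply: contraTneq lt_xi => <-; rewrite rz ltnn.
have z_star : z != star by move: z_out; rewrite inE negb_or => /andP[].
have Yi : Y i = rho x by rewrite ffunE tpermL swap_rows_star // last_rcons.
have Yz : Y z = rho x by rewrite ffunE tpermD 1?eq_sym // swap_rows_out.
apply/existsP; exists (i, z); rewrite /= eq_sym zi gz eqxx Yi Yz eqxx i_star z_star /=.
rewrite !inE i_star z_star Yi Yz /=; apply/andP; split; rewrite negb_forall; apply/existsP.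
  by exists i; rewrite eqxx /= -leqNgt ltnW.
by exists z; rewrite eqxx /= rz ltnn.
Qed.

Lemma walk_coefE d (rG : mx_representation F [set: 'S_N] d) phi v :
    (forall s X, rG s *m phi X = phi (row_act X s)) ->
    (forall X, v *m phi X = (poly_coef X)%:M :> 'M_1) ->
  forall j X, v *m (\sum_(i | i != star) rG (tperm i star)) ^+ j *m phi X = (walk_coef j X)%:M.
Proof.
move=> phiJ phi_v; elim=> [|j IHj] X; first by rewrite expr0 mulmx1 phi_v.
rewrite exprSr -mulmxE mulmxA -[LHS]mulmxA mulmx_suml mulmx_sumr raddf_sum /=.
by apply: eq_bigr => i _; rewrite phiJ IHj.
Qed.

Lemma star_powers_independent d (rG : mx_representation F [set: 'S_N] d) phi v xs
    (B := \sum_(i | i != star) rG (tperm i star)) :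
    (forall s X, rG s *m phi X = phi (row_act X s)) ->
    (forall X, v *m phi X = (poly_coef X)%:M :> 'M_1) -> bottom_chain xs ->
  forall k, (k < (size xs).+1)%N -> exists2 f : 'cV_d, v *m B ^+ k *m f = 1%:M &
    forall j, (j < k)%N -> v *m B ^+ j *m f = 0.
Proof.
move=> phiJ phi_v /andP[pxs bxs] k le_k.
have Ck : bottom_chain (take k xs).
  rewrite /bottom_chain take_path //=.
  by move: bxs => /= /andP[-> /allP bxs]; apply/allP=> x /mem_take/bxs.
have szk : size (take k xs) = k by rewrite size_takel.
(* The functional reads the tabloid reached by the first k swaps of the chain. *)
exists (phi (swap_rows (take k xs))) => [|j lt_j]; rewrite (walk_coefE phiJ phi_v).
  by rewrite -[in walk_coef k]szk walk_coef_swap.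
by rewrite walk_coef_swap_lt ?szk // raddf0.
Qed.

End StarWalks.

(** * Garnir relations *)

(** Off-diagonal terms cancel in pairs, without division by 2, so characteristic 2 is covered. *)
Lemma big_antisym (V : zmodType) k (P : pred 'I_k) (A : 'I_k -> 'I_k -> V) :
    (forall i j, P i -> P j -> i != j -> A i j = - A j i) ->
  \sum_(i | P i) \sum_(j | P j) A i j = \sum_(i | P i) A i i.
Proof.
move=> antiA.
transitivity (\sum_(i | P i) (A i i + (\sum_(j | P j && (j < i)%N) A i j +
                                 \sum_(j | P j && (i < j)%N) A i j))).
  apply: eq_bigr => i Pi; rewrite (bigD1 i) //=; congr (_ + _).
  rewrite (bigID (fun j : 'I_k => (j < i)%N)) /=.
  congr (_ + _); apply: eq_bigl => j; rewrite -(inj_eq val_inj) /= -andbA; congr (_ && _); lia.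
rewrite big_split /= [X in _ + X]big_split /=.
suff -> : \sum_(i | P i) \sum_(j | P j && (i < j)%N) A i j =
    - (\sum_(i | P i) \sum_(j | P j && (j < i)%N) A i j) by rewrite subrr addr0.
rewrite (exchange_big_dep P) /=; last by move=> i j _ /andP[].
rewrite -sumrN; apply: eq_bigr => i Pi; rewrite -sumrN; apply: eq_big => j; first by rewrite Pi.
by case/and3P=> Pj _ lt_ji; rewrite antiA // -(inj_eq val_inj) ltn_eqF.
Qed.

Section TableauGeometry.

Variables (n : nat) (la : seq nat).
Implicit Types (t : tableau n la) (s : 'S_n) (i j y z : 'I_n).

Fact tableau_surj t i : i \in codom (val t).
Proof. by case: t => t /= /andP[_ /forallP]. Qed.

Definition entry_node t i : node la := iinv (tableau_surj t i).
Definition row_of t i := node_row (entry_node t i).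
Definition col_of t i := node_col (entry_node t i).

Lemma entry_nodeK t i : val t (entry_node t i) = i.
Proof. exact: f_iinv. Qed.

Lemma node_entryK t x : entry_node t (val t x) = x.
Proof.
have /injectiveP t_inj : injectiveb (val t) by case: t => t /= /andP[].
by apply: t_inj; rewrite entry_nodeK.
Qed.

Lemma node_eq (x y : node la) :
  node_row x = node_row y -> node_col x = node_col y -> x = y.
Proof.
case: x y => [r c] [r' c']; rewrite /node_row /node_col /= => /val_inj rr'.
by case: r' / rr' c' => c' /val_inj ->.
Qed.

Lemma row_col_inj t i j : row_of t i = row_of t j -> col_of t i = col_of t j -> i = j.
Proof. by move=> rij cij; rewrite -(entry_nodeK t i) -(entry_nodeK t j) (node_eq rij cij). Qed.

Lemma col_of_lt t i : (col_of t i < nth 0%N la (row_of t i))%N.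
Proof. exact: ltn_ord. Qed.

Lemma entry_exists t r c :
  (c < nth 0%N la r)%N -> exists i, row_of t i = r /\ col_of t i = c.
Proof.
move=> lt_c; have lt_r : (r < size la)%N.
  by rewrite ltnNge; apply: contraL lt_c => /(nth_default 0%N)->.
exists (val t (@Tagged _ (Ordinal lt_r) (fun r => 'I_(nth 0%N la r)) (Ordinal lt_c))).
by rewrite /row_of /col_of node_entryK.
Qed.

Lemma entry_node_act t s i : entry_node (tableau_act t s) i = entry_node t (s^-1%g i).
Proof.
have iE : i = val (tableau_act t s) (entry_node t (s^-1%g i)) by rewrite ffunE entry_nodeK permKV.
by rewrite {1}iE node_entryK.
Qed.

Lemma row_of_act t s i : row_of (tableau_act t s) i = row_of t (s^-1%g i).
Proof. by rewrite /row_of entry_node_act. Qed.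

Lemma col_of_act t s i : col_of (tableau_act t s) i = col_of t (s^-1%g i).
Proof. by rewrite /col_of entry_node_act. Qed.

Lemma column_stabP t s : reflect (forall i, col_of t (s i) = col_of t i) (s \in column_stab t).
Proof.
rewrite inE; apply: (iffP forallP) => [col_s i | col_s x].
  have /existsP[y /andP[/eqP cy /eqP sy]] := col_s (entry_node t i).
  by move: sy cy; rewrite entry_nodeK => ->; rewrite /col_of node_entryK.
apply/existsP; exists (entry_node t (s (val t x))).
by rewrite entry_nodeK eqxx andbT; apply/eqP; rewrite [LHS]col_s /col_of node_entryK.
Qed.

Lemma row_sets_row_of t (u : 'I_(size la)) : row_sets t u = [set i | row_of t i == u].
Proof.
apply/setP=> i; rewrite ffunE inE; apply/imsetP/eqP => [[x xu ->]|iu].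
  by move: xu; rewrite inE /row_of node_entryK => /eqP<-.
exists (entry_node t i); last by rewrite entry_nodeK.
by rewrite inE; apply/eqP/val_inj.
Qed.

Lemma tabloid_of_eq t t' : row_of t =1 row_of t' -> tabloid_of t = tabloid_of t'.
Proof.
move=> rtt'; apply: val_inj; apply/ffunP=> u; rewrite !row_sets_row_of.
by apply/setP=> i; rewrite !inE rtt'.
Qed.

Variable F : fieldType.

(** The transposition lies in the column stabilizer, and translating the sum by it flips every
    sign. *)
Lemma polytabloid_same_col t y z :
    y != z -> col_of t y = col_of t z ->
  polytabloid F (tableau_act t (tperm y z)) = - polytabloid F t.
Proof.
move=> yz cyz; have col_yz i : col_of t (tperm y z i) = col_of t i by case: tpermP => [->|->|].
have stabE s : (s \in column_stab (tableau_act t (tperm y z))) = (s \in column_stab t).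
  by apply/column_stabP/column_stabP => col_s i; have := col_s i;
    rewrite !col_of_act tpermV !col_yz.
rewrite /polytabloid -sumrN [RHS](reindex_inj (mulgI (tperm y z))) /=.
apply: eq_big => [s|s _]; last first.
  by rewrite tableau_actM odd_permM odd_tperm yz signr_addb expr1 mulN1r scaleNr opprK.
rewrite stabE; apply/column_stabP/column_stabP => col_s i; first by rewrite permM col_s col_yz.
by have := col_s (tperm y z i); rewrite permM tpermK col_yz.
Qed.

(* Each term {t s} of e_t meets exactly one entry z' of column c in the row of y.
   Swapping y with z' fixes {t s}, and the other swaps cancel in pairs. *)
Lemma garnir t y c :
    col_of t y != c ->
    (forall r, (col_of t y < nth 0%N la r)%N -> (c < nth 0%N la r)%N) ->
  \sum_(z | col_of t z == c) polytabloid F (tableau_act t (tperm y z)) = polytabloid F t.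
Proof.
move=> cy taller; pose V u : 'rV[F]_#|tabloid n la| := tabloid_vec F (tabloid_of u).
pose level s z := row_of (tableau_act t s) z == row_of (tableau_act t s) y.
(* The part of the term for z coming from the tabloids with z' in the row of y. The diagonal sums to
   e_t, and A is antisymmetric off the diagonal. *)
pose A z z' := \sum_(s in column_stab t | level s z')
  (-1) ^+ s *: V (tableau_act (tableau_act t s) (tperm y z)).
have levelP s : s \in column_stab t ->
    exists z, [pred z | (col_of t z == c) && level s z] =1 pred1 z.
  move=> Cs; have cE i : col_of (tableau_act t s) i = col_of t i.
    by rewrite col_of_act; have /column_stabP/(_ (s^-1%g i)) := Cs; rewrite permKV.
  have [|z [rz cz]] := @entry_exists (tableau_act t s) (row_of (tableau_act t s) y) c.
    by apply: taller; rewrite -cE col_of_lt.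
  exists z => z' /=; apply/andP/eqP => [[/eqP cz' /eqP rz']|->].
    by apply: (@row_col_inj (tableau_act t s)); rewrite ?rz ?rz' // cz cE.
  by rewrite /level rz eqxx -cE cz eqxx.
have y_out z : col_of t z == c -> z != y by apply: contraTneq => ->.
have VE s z : level s z ->
    tabloid_of (tableau_act (tableau_act t s) (tperm y z)) = tabloid_of (tableau_act t s).
  move=> /eqP rz; apply: tabloid_of_eq => i.
  by rewrite row_of_act tpermV; case: tpermP => [->|->|].
have sumV : \sum_(z | col_of t z == c) A z z = polytabloid F t.
  rewrite /A (exchange_big_dep (mem (column_stab t))) /=; last by move=> z s _ /andP[].
  apply: eq_bigr => s Cs; have [z zP] := levelP s Cs.
  rewrite (big_pred1 z) => [|z']; last by rewrite Cs -zP.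
  by rewrite /V VE //; have := zP z; rewrite /= eqxx => /andP[].
rewrite -[RHS]sumV -big_antisym => [|z z' cz cz' zz'].
  apply: eq_bigr => z cz; rewrite -polytabloid_act mulmx_suml.
  rewrite /A (exchange_big_dep (mem (column_stab t))) /=; last by move=> z' s _ /andP[].
  apply: eq_bigr => s Cs; have [z' zP] := levelP s Cs.
  rewrite (big_pred1 z') => [|z'']; last by rewrite Cs -zP.
  by rewrite -scalemxAl tabloid_vec_act tabloid_act_of.
rewrite /A [in LHS](reindex_inj (mulIg (tperm z z'))) -sumrN /=.
have [yz yz'] : y != z /\ y != z' by rewrite ![y == _]eq_sym !y_out.
have levelE s : level (s * tperm z z')%g z' = level s z.
  by rewrite /level !tableau_actM ![row_of (tableau_act _ (tperm z z')) _]row_of_act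
             tpermV tpermR tpermD // eq_sym.
apply: eq_big => [s|s]; rewrite levelE.
  congr (_ && _); apply/column_stabP/column_stabP => col_s i; have := col_s i; rewrite permM;
    by case: tpermP => [->|->|]; rewrite ?(eqP cz) ?(eqP cz').
case/andP=> _ lev; rewrite odd_permM odd_tperm zz' signr_addb expr1 mulrN1 scaleNr.
congr (- (_ *: _)).
(* Here (z z')(y z) = (y z)(y z'), and its first factor fixes the tabloid of [tableau_act t s],
   where z lies in the row of y. *)
have -> : tableau_act (tableau_act t (s * tperm z z')%g) (tperm y z)
    = tableau_act (tableau_act (tableau_act t s) (tperm y z)) (tperm y z').
  rewrite -!tableau_actM; congr tableau_act; rewrite -!mulgA; congr (_ * _)%g.
  by rewrite conjgC tpermJ tpermR tpermD.
by rewrite /V -tabloid_act_of VE // tabloid_act_of.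
Qed.

End TableauGeometry.

(** * Specht modules *)

(** The parts of the conjugate partition, with columns numbered from 0. *)
Definition col_height (la : seq nat) (c : nat) : nat := count (fun p => (c < p)%N) la.

Lemma ltn_col_height la c r :
  sorted geq la -> (r < col_height la c)%N = (c < nth 0%N la r)%N.
Proof.
elim: la r => [|p la IHla] r /=; first by rewrite nth_nil ltn0.
move=> p_la; have srt := path_sorted p_la.
have geq_trans : transitive geq by move=> x y z xy yz; apply: leq_trans yz xy.
have [lt_cp|le_pc] := ltnP c p; first by case: r => //= r; rewrite ltnS IHla.
have /allP le_p := order_path_min geq_trans p_la.
have -> : col_height la c = 0%N.
  by apply/eqP; rewrite -leqn0 leqNgt -has_count; apply/hasPn => q /le_p /=; lia.
case: r => [|r] /=; first by rewrite (ltnNge c) le_pc.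
apply/esym/negbTE; rewrite -leqNgt; apply: leq_trans le_pc.
have [lt_r|le_r] := ltnP r (size la); first exact/le_p/mem_nth.
by rewrite nth_default.
Qed.

Lemma big_fiber (V : nmodType) k (P : pred 'I_k) (f : 'I_k -> nat) K (g : 'I_k -> V) :
  \sum_(z | P z && (f z < K)%N) g z = \sum_(c < K) \sum_(z | P z && (f z == c)) g z.
Proof.
rewrite (exchange_big_dep (fun z => P z && (f z < K)%N)) /=.
  by apply: eq_bigr => z /andP[Pz fz]; rewrite (big_pred1 (Ordinal fz)) // => c; rewrite Pz eq_sym.
by move=> c z _ /andP[-> /eqP->] /=.
Qed.

Lemma residue_sum_tableau (F : fieldType) n la (t : tableau n la) :
  residue_sum F la = \sum_y ((col_of t y)%:R - (row_of t y)%:R).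
Proof.
rewrite /residue_sum (reindex (entry_node t)) //.
by exists (val t) => x _; rewrite ?entry_nodeK ?node_entryK.
Qed.

Lemma card_column n la (t : tableau n la) c k :
    (forall r, (r < k)%N -> (c < nth 0%N la r)%N) ->
  #|[pred z | (col_of t z == c) && (row_of t z < k)%N]| = k.
Proof.
move=> col_k; rewrite -sum1_card.
transitivity (\sum_(r < k) \sum_(z | (col_of t z == c) && (row_of t z == r)) 1)%N.
  by rewrite -big_fiber; apply: eq_bigl => z; rewrite inE.
rewrite (eq_bigr (fun=> 1%N)) ?sum1_card ?card_ord // => r _.
have [z [rz cz]] := entry_exists t (col_k r (ltn_ord r)).
rewrite (big_pred1 z) // => z'; apply/andP/eqP => [[/eqP cz' /eqP rz']|->].
  by apply: (@row_col_inj _ _ t); rewrite ?rz ?cz.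
by rewrite rz cz.
Qed.

Section SpechtVectors.

Variables (F : fieldType) (n : nat) (la : seq nat).
Hypothesis la_sorted : sorted geq la.
Implicit Types (t : tableau n la) (s : 'S_n) (i y z : 'I_n).

Definition specht_vec t : 'rV[F]_(\rank (specht_mx n la F)) :=
  in_submod (specht_mx n la F) (polytabloid F t).

Lemma polytabloid_sub t : (polytabloid F t <= specht_mx n la F)%MS.
Proof. by apply: (sumsmx_sup t); rewrite // genmxE. Qed.

Lemma specht_vec_act t s :
  specht_vec t *m specht_repr n la F s = specht_vec (tableau_act t s).
Proof. by rewrite -in_submodJ ?polytabloid_sub //= polytabloid_act. Qed.

(** Reduces matrix identities on the Specht module to polytabloids. *)
Lemma specht_vec_span k (Z : 'M_(_, k)) : (forall t, specht_vec t *m Z = 0) -> Z = 0.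
Proof.
move=> Z0; set S := specht_mx n la F in Z Z0 *.
have : (S <= kermx (in_submod S 1%:M *m Z))%MS.
  apply/sumsmx_subP=> t _; rewrite genmxE; apply/sub_kermxP.
  by rewrite mulmxA -in_submodE Z0.
move/(submx_trans (val_submodP (1%:M : 'M_(\rank S)))) => /sub_kermxP.
by rewrite mulmxA -in_submodE val_submodK mul1mx.
Qed.

Lemma specht_vec_same_col t y z :
    y != z -> col_of t y = col_of t z ->
  specht_vec (tableau_act t (tperm y z)) = - specht_vec t.
Proof. by move=> yz cyz; rewrite /specht_vec polytabloid_same_col // linearN. Qed.

Lemma specht_vec_garnir t y c :
    col_of t y != c ->
    (forall r, (col_of t y < nth 0%N la r)%N -> (c < nth 0%N la r)%N) ->
  \sum_(z | col_of t z == c) specht_vec (tableau_act t (tperm y z)) = specht_vec t.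
Proof. by move=> cy taller; rewrite /specht_vec -linear_sum garnir. Qed.

Lemma leq_part r r' : (r <= r')%N -> (nth 0%N la r' <= nth 0%N la r)%N.
Proof.
move=> le_r; rewrite leqNgt; apply/negP => lt_r.
have := ltn_col_height (nth 0%N la r) r' la_sorted.
have := ltn_col_height (nth 0%N la r) r la_sorted; lia.
Qed.

Lemma card_col_of t c : #|[pred z | col_of t z == c]| = col_height la c.
Proof.
rewrite -[RHS](@card_column _ _ t c) => [|r]; last by rewrite ltn_col_height.
apply: eq_card => z; rewrite !inE; case: eqP => //= <-.
by rewrite ltn_col_height // col_of_lt.
Qed.

(* Each pair of entries is oriented so that its larger column, or lower row, comes
   first; the Garnir relations then count the columns to the left of an entry. *)
Lemma specht_vec_transpositions t :
  specht_vec t *m (\sum_(s in transpositions n) specht_repr n la F s)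
    = residue_sum F la *: specht_vec t.
Proof.
pose R y z := (col_of t z < col_of t y)%N ||
  (col_of t z == col_of t y) && (row_of t z < row_of t y)%N.
rewrite (@big_transpositions _ _ R); first last.
- by move=> y; rewrite /R !ltnn andbF.
- move=> y z yz; have : ~~ ((row_of t y == row_of t z) && (col_of t y == col_of t z)).
    by apply: contra yz => /andP[/eqP ryz /eqP cyz]; rewrite (row_col_inj ryz cyz).
  by rewrite /R; lia.
rewrite mulmx_sumr (residue_sum_tableau F t) scaler_suml; apply: eq_bigr => y _.
rewrite mulmx_sumr (bigID (fun z => (col_of t z < col_of t y)%N)) /= scalerBl; congr (_ + _).
  transitivity (\sum_(z | true && (col_of t z < col_of t y)%N)
                  specht_vec (tableau_act t (tperm y z))).
    apply: eq_big => [z|z _]; last by rewrite specht_vec_act.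
    by rewrite /R; case: (_ < _)%N; rewrite ?andbF.
  rewrite big_fiber (eq_bigr (fun=> specht_vec t)) ?sumr_const ?card_ord ?scaler_nat // => c _.
  by apply: specht_vec_garnir => [|r]; [rewrite gtn_eqF | apply: ltn_trans].
transitivity (\sum_(z | (col_of t z == col_of t y) && (row_of t z < row_of t y)%N) - specht_vec t).
  apply: eq_big => [z|z]; first by rewrite /R; case: ltngtP; rewrite ?andbF ?andbT.
  rewrite specht_vec_act => /andP[/orP[-> //|/andP[/eqP cz rz]] _].
  by rewrite specht_vec_same_col //; apply: contraTneq rz => ->; rewrite ltnn.
rewrite sumrN sumr_const.
rewrite (eq_card (B := [pred z | (col_of t z == col_of t y) && (row_of t z < row_of t y)%N])) //.
rewrite card_column ?scaler_nat // => r lt_r.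
exact: leq_trans (col_of_lt t y) (leq_part (ltnW lt_r)).
Qed.

(** The columns before K are those of height at least h. By Garnir each of the K - 1 others among
    them gives e_t; the column of x itself gives - e_t for each of its h - 1 other entries. *)
Lemma specht_vec_star t x (h := col_height la (col_of t x)) (K := nth 0%N la h.-1) :
  specht_vec t *m (\sum_(i | i != x) specht_repr n la F (tperm i x))
    = (K%:R - h%:R) *: specht_vec t
      + \sum_(i | (K <= col_of t i)%N) specht_vec (tableau_act t (tperm i x)).
Proof.
have h_gt : (row_of t x < h)%N by rewrite ltn_col_height ?col_of_lt.
have hK : (col_of t x < K)%N by rewrite /K -ltn_col_height // -/h; case: (h) h_gt.
rewrite mulmx_sumr (bigID (fun i => (col_of t i < K)%N)) /=; congr (_ + _); last first.
  apply: eq_big => i; last by rewrite specht_vec_act.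
  by rewrite -leqNgt; case: eqP => //= ->; rewrite leqNgt hK.
rewrite big_fiber (bigD1 (Ordinal hK)) //=.
transitivity (\sum_(i | (i != x) && (col_of t i == col_of t x)) - specht_vec t
              + \sum_(c < K | c != Ordinal hK) specht_vec t).
  congr (_ + _); [apply: eq_bigr => i /andP[ix /eqP cix] | apply: eq_bigr => c cx].
    by rewrite specht_vec_act specht_vec_same_col.
  have cx' : col_of t x != c by rewrite eq_sym.
  rewrite -[RHS](@specht_vec_garnir t x c) //.
    apply: eq_big => i; last by rewrite specht_vec_act tpermC.
    by case: eqP => //= ->; rewrite (negPf cx').
  move=> r; rewrite -!ltn_col_height // -/h; have := ltn_ord c.
  by rewrite /K -ltn_col_height //; lia.
rewrite !sumr_const; set a := #|_|; set b := #|_|.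
have -> : a = h.-1.
  have := card_col_of t (col_of t x); rewrite -/h (cardD1 x) inE eqxx add1n => <- /=.
  by apply: eq_card => i; rewrite !inE.
have -> : b = K.-1.
  have := card_ord K; rewrite (cardD1 (Ordinal hK)) inE add1n => cK; rewrite -[in RHS]cK /=.
  by apply: eq_card => i; rewrite !inE andbT.
move=> {a b}; case: (h) h_gt (K) hK => // h' _ [] // K' _ /=.
by rewrite -!scaler_nat scalerN -scaleNr -scalerDl !mulrSr opprD addrACA subrr addr0 addrC.
Qed.

End SpechtVectors.

(** * Induced modules *)

Section InducedTensors.

Variables (F : fieldType) (aT rT : finGroupType) (H : {group aT}).
Variables (f : {morphism H >-> rT}) (d : nat) (rH : mx_representation F H d).

Local Notation G := [set: rT]%G.
Local Notation U := (tensor_rel_mx f rH).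

Definition pure_tensor (g : rT) (v : 'rV[F]_d) : 'rV[F]_(d * #|[set: rT]|) :=
  mxvec (v^T *m delta_mx 0 (gring_index G g)).

Definition tens (g : rT) (v : 'rV[F]_d) : 'rV[F]_(\rank (cokermx U)) :=
  in_factmod U (pure_tensor g v).

Lemma pure_tensor_span k (Z : 'M_(_, k)) : (forall v g, pure_tensor g v *m Z = 0) -> Z = 0.
Proof.
move=> Z0; apply/row_matrixP=> i; rewrite row0 rowE.
case/mxvec_indexP: i => a b; rewrite -mxvec_delta -[RHS](Z0 (delta_mx 0 a) (enum_val b)).
by rewrite /pure_tensor gring_valK trmx_delta mul_delta_mx.
Qed.

Lemma pure_tensor_rel v g h :
  pure_tensor g v *m (lin_mulmx (rH h)^T - lin_mulmxr (left_regular_mx F (f h)))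
    = pure_tensor g (v *m rH h) - pure_tensor (f h * g)%g v.
Proof.
rewrite mulmxBr !mul_vec_lin /=; congr (mxvec _ - mxvec _).
  by rewrite trmx_mul mulmxA.
by rewrite -mulmxA -rowE rowK gring_indexK ?inE.
Qed.

Lemma tens_mul v g h : h \in H -> tens g (v *m rH h) = tens (f h * g)%g v.
Proof.
move=> Hh; apply/eqP; rewrite -subr_eq0 -linearB /= in_factmod_eq0 -pure_tensor_rel.
by apply: submx_trans (submxMl _ _) (sumsmx_sup h _ _).
Qed.

Lemma tens_act v g x : tens g v *m ind_repr f rH x = tens (g * x)%g v.
Proof.
rewrite -in_factmodJ ?inE //=; congr in_factmod.
by rewrite mul_vec_lin /= -mulmxA -rowE rowK gring_indexK ?inE.
Qed.

Lemma tensD g : {morph tens g : v w / v + w}.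
Proof. by move=> v w; rewrite /tens /pure_tensor linearD mulmxDl !linearD. Qed.

Lemma tensZ g a : {morph tens g : v / a *: v}.
Proof. by move=> v; rewrite /tens /pure_tensor linearZ -scalemxAl !linearZ. Qed.

Lemma tensN g : {morph tens g : v / - v}.
Proof. by move=> v; rewrite -scaleN1r tensZ scaleN1r. Qed.

Lemma tens_sum g I r (P : pred I) (v : I -> 'rV[F]_d) :
  tens g (\sum_(i <- r | P i) v i) = \sum_(i <- r | P i) tens g (v i).
Proof. by apply: (big_morph _ (tensD g)); rewrite -(scale0r 0) tensZ scale0r. Qed.

Definition tens_mx g := \matrix_i tens g (delta_mx 0 i).

Lemma tens_mxE g v : tens g v = v *m tens_mx g.
Proof.
rewrite {1}[v]row_sum_delta tens_sum mulmx_sum_row.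
by apply: eq_bigr => i _; rewrite tensZ rowK.
Qed.

Lemma tens_span k (Z : 'M_(_, k)) : (forall v g, tens g v *m Z = 0) -> Z = 0.
Proof.
move=> Z0; suff : in_factmod U 1%:M *m Z = 0.
  by move=> UZ0; rewrite -[Z]mul1mx -[1%:M](val_factmodK) in_factmodE -mulmxA UZ0 mulmx0.
by apply: pure_tensor_span => v g; rewrite mulmxA -in_factmodE Z0.
Qed.

(** The universal property of the tensor product: a balanced family of functionals kills the
    relations, hence descends to the quotient. *)
Lemma tens_universal (psi : rT -> 'cV[F]_d) :
    (forall h g, h \in H -> rH h *m psi g = psi (f h * g)%g) ->
  {phi | forall v g, tens g v *m phi = v *m psi g}.
Proof.
move=> psiM; pose phi0 := (mxvec (\matrix_(a < d, b < #|[set: rT]|) psi (enum_val b) a 0))^T.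
have phi0E v g : pure_tensor g v *m phi0 = v *m psi g.
  rewrite mxvec_dotmul -mulmxA trmx_delta -colE; congr (_ *m _).
  by apply/colP=> a; rewrite !mxE gring_indexK ?inE.
have U0 : (U <= kermx phi0)%MS.
  apply/sumsmx_subP=> h Hh; apply/sub_kermxP/pure_tensor_span => v g.
  by rewrite mulmxA pure_tensor_rel mulmxBl !phi0E -mulmxA psiM // subrr.
exists (val_factmod 1%:M *m phi0) => v g; rewrite mulmxA -val_factmodE /tens.
set w := pure_tensor g v; rewrite -phi0E -/w -[w in RHS](add_sub_fact_mod U) mulmxDl.
suff -> : val_submod (in_submod U w) *m phi0 = 0 by rewrite add0r.
by apply/sub_kermxP/(submx_trans (val_submodP _)).
Qed.

End InducedTensors.

(** * Removable nodes and residues *)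

(** The list behind [corner_row], without the leading 0. Its members are also the column heights,
    and [0 :: corners la] lists the rows of the addable nodes numbered from 0. *)
Definition corners (la : seq nat) : seq nat :=
  [seq r <- iota 1 (size la) | (nth 0 la r < nth 0 la r.-1)%N].

(** By induction on the rows: the first row ends in a removable node exactly when its length does
    not recur below, which is also when [undup] keeps it. *)
Lemma size_corners la : sorted geq la -> 0%N \notin la -> size (corners la) = size (undup la).
Proof.
elim: la => //= p la IHla p_la; rewrite inE negb_or eq_sym => /andP[p0 la0].
have size_tail : size [seq r <- iota 2 (size la) | (nth 0 (p :: la) r < nth 0 (p :: la) r.-1)%N]
    = size (corners la).
  rewrite -[2%N]/(1 + 1)%N iotaDl filter_map size_map /corners; congr size.
  by apply: eq_in_filter => -[|r]; rewrite mem_iota.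
have lt_p : (nth 0 la 0 < p)%N = (p \notin la).
  case: la p_la {IHla la0 size_tail} => [_|q la /=]; first by rewrite lt0n p0.
  have geq_trans : transitive geq by move=> x y z xy yz; apply: leq_trans yz xy.
  case/andP=> le_qp /(order_path_min geq_trans)/allP le_q; rewrite inE negb_or.
  have [lt_qp|le_pq] := ltnP q p; last first.
    by rewrite (_ : p = q) ?eqxx //; apply/eqP; rewrite eqn_leq le_pq.
  by rewrite gtn_eqF //=; apply/esym/negP => /le_q /=; lia.
rewrite /corners /= lt_p (fun_if size) /= size_tail IHla ?(path_sorted p_la) //.
by case: (p \in la).
Qed.

Section Residues.

Variable F : fieldType.

(** Padding with empty rows lets two partitions be compared over a common range. *)
Lemma residue_sum_rows mu R : (size mu <= R)%N ->
  residue_sum F mu = \sum_(r < R) \sum_(c < nth 0%N mu r) (c%:R - r%:R).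
Proof.
move=> le_R; pose G r : F := \sum_(c < nth 0%N mu r) (c%:R - r%:R).
transitivity (\sum_(r < size mu) G r).
  by rewrite /residue_sum /G sig_big_dep.
rewrite (big_ord_widen _ G le_R) big_mkcond; apply: eq_bigr => r _.
by case: ltnP => // le_r; rewrite nth_default // big_ord0.
Qed.

Lemma residue_sum_add_node mu nu r :
    (forall k, k != r -> nth 0%N nu k = nth 0%N mu k) -> nth 0%N nu r = (nth 0%N mu r).+1 ->
  residue_sum F nu = residue_sum F mu + ((nth 0%N mu r)%:R - r%:R).
Proof.
move=> same_rows row_r; set R := maxn (maxn (size mu) (size nu)) r.+1.
have lt_r : (r < R)%N by rewrite leq_maxr.
rewrite !(@residue_sum_rows _ R) ?leq_max ?leqnn ?orbT //.
rewrite (bigD1 (Ordinal lt_r)) //= [in RHS](bigD1 (Ordinal lt_r)) //= row_r big_ord_recr /=.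
rewrite [LHS]addrAC; congr (_ + _ + _); apply: eq_bigr => k.
rewrite -(inj_eq val_inj) /= => kr.
by rewrite same_rows.
Qed.

Lemma residue_sum_part_up la r :
  residue_sum F (incr_nth la r) = residue_sum F la + ((nth 0%N la r)%:R - r%:R).
Proof.
by apply: residue_sum_add_node => [k kr|]; rewrite nth_incr_nth 1?eq_sym ?(negPf kr) ?eqxx.
Qed.

End Residues.

(** In a nonincreasing sequence the zeros come last, so removing them shifts nothing. *)
Lemma nth_filter_neq0 s r :
  (forall k, (nth 0 s k.+1 <= nth 0 s k)%N) -> nth 0%N [seq p <- s | p != 0%N] r = nth 0%N s r.
Proof.
elim: s r => // p s IHs r dec; have {IHs} IHs := IHs _ (fun k => dec k.+1).
case: p => [|p] /= in dec *; last by case: r => /=.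
have s0 k : nth 0%N s k = 0%N.
  by elim: k => [|k IHk]; [have := dec 0%N | have := dec k.+1]; rewrite /=; lia.
by rewrite IHs s0; case: r => //= r; rewrite s0.
Qed.

Lemma residue_sum_corner (F : fieldType) la r :
    sorted geq la -> r \in corners la ->
  residue_sum F [seq p <- set_nth 0 la r.-1 (nth 0 la r.-1).-1 | p != 0]%N
    = residue_sum F la - ((nth 0%N la r.-1)%:R - r%:R).
Proof.
move=> srt; rewrite mem_filter mem_iota => /andP[lt_r /andP[r_gt0 _]].
set s := set_nth _ _ _ _.
have sE k : nth 0%N s k = if k == r.-1 then (nth 0%N la r.-1).-1 else nth 0%N la k.
  by rewrite nth_set_nth.
have dec k : (nth 0 s k.+1 <= nth 0 s k)%N.
  have := leq_part srt (leqnSn k); rewrite !sE; case: eqP => [->|_]; case: eqP => [->|]; try lia.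
  by rewrite prednK //; lia.
rewrite [in RHS](@residue_sum_add_node F [seq p <- s | p != 0]%N la r.-1) ?nth_filter_neq0 //.
- have a_gt0 : (0 < nth 0%N la r.-1)%N by apply: leq_ltn_trans lt_r.
  (* The removed node has 0-based coordinates one less than a and b, with the same difference. *)
  have pred_sub a b : (0 < a)%N -> (0 < b)%N -> a.-1%:R - b.-1%:R = a%:R - b%:R :> F.
    case: a b => // a [] // b _ _.
    by rewrite -[in RHS]natr1 -[b.+1%:R]natr1 opprD addrACA subrr addr0.
  by rewrite sE eqxx pred_sub // addrK.
- by move=> k /negPf kr; rewrite nth_filter_neq0 // sE kr.
- by rewrite ?nth_filter_neq0 // sE eqxx prednK //; apply: leq_ltn_trans lt_r.
Qed.

(** * Restriction *)

Lemma card_node n la : is_partition_of n la -> #|node la| = n.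
Proof.
case/and3P=> _ _ /eqP<-; rewrite card_tagged !sumnE big_image /= [RHS](big_nth 0%N) big_mkord.
by apply: eq_bigr => i _; rewrite card_ord.
Qed.

Lemma tableau_with_entry n la (x : 'I_n) r c :
    is_partition_of n la -> (c < nth 0%N la r)%N ->
  exists t : tableau n la, row_of t x = r /\ col_of t x = c.
Proof.
move=> la_part lt_c; have cardE := card_node la_part.
pose t0 := [ffun y : node la => cast_ord cardE (enum_rank y)].
have t0_inj : injective t0 by move=> y z; rewrite !ffunE => /cast_ord_inj/enum_rank_inj.
have t0P : is_tableau t0.
  apply/andP; split; first exact/injectiveP.
  by apply/forallP=> i; apply: inj_card_onto => //; rewrite card_ord cardE.
pose t : tableau n la := Sub t0 t0P.
have [i [ri ci]] := entry_exists t lt_c.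
by exists (tableau_act t (tperm i x)); rewrite row_of_act col_of_act tpermV tpermR.
Qed.

(** * Entries at the removable nodes *)

Section Chains.

Variables (n : nat) (la : seq nat).
Hypothesis la_sorted : sorted geq la.
Implicit Type t : tableau n la.

Lemma tableau_columns_closed t i r :
  (r < row_of t i)%N -> exists2 z, col_of t z = col_of t i & row_of t z = r.
Proof.
move=> lt_r; have [|z [rz cz]] := @entry_exists _ _ t r (col_of t i); last by exists z.
exact: leq_trans (col_of_lt t i) (leq_part la_sorted (ltnW lt_r)).
Qed.

Definition corner_entry t (x : 'I_n) : bool :=
  ((row_of t x).+1 \in corners la) && ((col_of t x).+1 == nth 0%N la (row_of t x)).

(** The row below a corner is too short to reach its column. *)
Lemma corner_entry_bottom t x i :
  corner_entry t x -> col_of t i = col_of t x -> (row_of t i <= row_of t x)%N.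
Proof.
case/andP; rewrite mem_filter /= => /andP[lt_r _] /eqP cx ci.
rewrite leqNgt; apply/negP=> /(leq_part la_sorted); have := col_of_lt t i; lia.
Qed.

Lemma corner_entries t rs : {subset rs <= corners la} ->
  exists2 xs, [seq (row_of t x).+1 | x <- xs] = rs & all (corner_entry t) xs.
Proof.
elim: rs => [|r rs IHrs] sub_rs; first by exists [::].
have [k k_rs|xs def_rs xsP] := IHrs; first by apply: sub_rs; rewrite inE k_rs orbT.
have r_corner : r \in corners la by apply: sub_rs; rewrite inE eqxx.
move: (r_corner); rewrite mem_filter mem_iota => /andP[lt_r /andP[r_gt0 _]].
have [|x [rx cx]] := @entry_exists _ _ t r.-1 (nth 0%N la r.-1).-1.
  by rewrite prednK //; apply: leq_ltn_trans lt_r.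
exists (x :: xs); first by rewrite /= def_rs rx prednK.
rewrite /= xsP andbT /corner_entry rx cx !prednK ?r_corner ?eqxx //.
exact: leq_ltn_trans lt_r.
Qed.

Lemma sorted_rev_corners : sorted gtn (rev (corners la)).
Proof.
by rewrite rev_sorted; apply: sorted_filter (iota_ltn_sorted _ _); apply: ltn_trans.
Qed.

End Chains.

(** * Coefficients of tabloids as functionals on the Specht module *)

Section SpechtFunctionals.

Variables (F : fieldType) (n : nat) (la : seq nat).
Implicit Types (X : {ffun 'I_n -> nat}) (t : tableau n la).

(** The indicator column vanishes when X describes no tabloid, so X may be arbitrary. *)
Definition specht_coord X : 'cV[F]_(\rank (specht_mx n la F)) :=
  val_submod 1%:M *m
    \col_T [forall u, val (enum_val T : tabloid n la) u == [set i | X i == u]]%:R.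

Lemma specht_coord_act s X :
  specht_repr n la F s *m specht_coord X = specht_coord (row_act X s).
Proof.
rewrite mulmxA -val_submodE -[specht_repr _ _ _ s]mul1mx val_submodJ ?inE // -mulmxA.
congr (_ *m _); apply/row_matrixP=> i; rewrite row_mul rowK -rowE.
apply/rowP=> j; rewrite !mxE enum_rankK; congr (_%:R); congr nat_of_bool.
apply: eq_forallb => u; rewrite ffunE.
apply/eqP/eqP => [/setP eqX|->]; apply/setP=> k.
  by rewrite inE ffunE; have := eqX (s k); rewrite inE (mem_imset _ _ (@perm_inj _ s)).
by rewrite -[k](permKV s) (mem_imset _ _ (@perm_inj _ s)) !inE ffunE.
Qed.

Lemma specht_coord_vec t X :
  specht_vec F t *m specht_coord X = (poly_coef F (row_of t) (col_of t) X)%:M.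
Proof.
rewrite mulmxA -val_submodE in_submodK ?polytabloid_sub // mulmx_suml raddf_sum /=.
apply: eq_big => s; first by apply/column_stabP/forallP => [cs i|cs i]; apply/eqP.
move=> _; rewrite -scalemxAl -rowE; apply/rowP=> j; rewrite !mxE ord1 eqxx mulr1n enum_rankK.
congr (_ * _%:R); congr nat_of_bool; apply/forallP/forallP => [rowX i|rowX u].
  have lt_i : (row_of t i < size la)%N.
    by rewrite ltnNge; apply: contraL (col_of_lt t i) => /(nth_default 0%N)->.
  have /eqP/setP/(_ (s i)) := rowX (Ordinal lt_i).
  by rewrite row_sets_row_of !inE row_of_act permK eqxx.
rewrite row_sets_row_of; apply/eqP/setP=> i; rewrite !inE row_of_act.
by rewrite -[in RHS](permKV s i) (eqP (rowX _)).
Qed.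

End SpechtFunctionals.

(** * The minimal polynomial on the restriction *)

Section Restriction.

Variables (F : fieldType) (n : nat) (la : seq nat).
Hypothesis la_part : is_partition_of n.+1 la.

Let la_sorted : sorted geq la. Proof. by case/and3P: la_part. Qed.
Local Notation rG := (specht_repr n.+1 la F).
Local Notation A := (gring_op (res_repr rG) (E_elt F n)).
Let B := \sum_(i | i != ord_max) rG (tperm i ord_max).
Let c_ r : F := residue_sum F la - ((nth 0%N la r.-1)%:R - r%:R).

(** The sum of all transpositions is a scalar on the Specht module, and those moving the last point
    make up B. *)
Lemma res_E_star : A = (residue_sum F la)%:M - B.
Proof.
apply/eqP; rewrite -subr_eq0; apply/eqP; apply: specht_vec_span => // t.
rewrite opprB addrA mulmxBr mul_mx_scalar -specht_vec_transpositions //.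
rewrite big_transpositions_last /E_elt /gset_mx linear_sum -mulmxBr.
rewrite opprD addrACA subrr addr0; set S1 := \sum_(i in _) _; set S2 := \sum_(i in _) _.
suff -> : S1 = S2 by rewrite subrr mulmx0.
by apply: eq_bigr => s _; rewrite /= gring_opG ?inE.
Qed.

Lemma col_height_corner (t : tableau n.+1 la) x :
  col_height la (col_of t x) \in corners la.
Proof.
set h := col_height _ _.
have h_gt0 : (0 < h)%N.
  by rewrite ltn_col_height //; apply: leq_trans (col_of_lt t x) (leq_part la_sorted (leq0n _)).
rewrite mem_filter mem_iota h_gt0 add1n ltnS count_size !andbT.
have := ltn_col_height (col_of t x) h la_sorted; rewrite ltnn => /esym/negbT.
rewrite -leqNgt => /leq_ltn_trans-> //.
by rewrite -ltn_col_height // -/h; case: (h) h_gt0.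
Qed.

(* Modulo the polytabloids with the last point in a shorter column, the star
   element acts on those with it in a column of height h by the residue of that
   column's bottom node. *)
Lemma res_star_kill k (t : tableau n.+1 la) :
    (col_height la (col_of t ord_max) <= k)%N ->
  specht_vec F t *m (\prod_(r <- [seq r <- iota 1 k | r \in corners la]) (A - (c_ r)%:M)) = 0.
Proof.
elim: k t => [|k IHk] t.
  rewrite leqn0 => /eqP h0; have := col_height_corner t ord_max.
  by rewrite h0 mem_filter mem_iota andbF.
rewrite -[k.+1]addn1 iotaD filter_cat big_cat /= add1n addn1 => le_h.
set L := [seq _ <- _ | _] in IHk *.
have [k_corner|nk] := boolP (k.+1 \in corners la); last first.
  rewrite big_nil mulr1 IHk // -ltnS ltn_neqAle le_h andbT.
  by apply: contraNneq nk => <-; apply: col_height_corner.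
rewrite big_seq1; move: le_h; rewrite leq_eqVlt => /predU1P[hE|le_h]; last first.
  by rewrite mulmxA IHk // mul0mx.
have cAA : comm_mx A (A - (c_ k.+1)%:M).
  by apply: comm_mx_sym; rewrite /comm_mx mulmxBl mulmxBr scalar_mxC.
(* The factors commute, so the new one is applied first. Its root cancels the scalar of
   [specht_vec_star], and the remaining polytabloids have the last point in columns of height at
   most k. *)
rewrite -(big_map c_ xpredT (fun c => A - c%:M)) -mulmxE -(prod_subC_comm _ cAA) big_map.
rewrite mulmxA res_E_star mulmxBr mulmxBr !mul_mx_scalar specht_vec_star // hE.
rewrite addrAC -scalerBl [c_ _]/(_ - _) opprB addrCA subrr addr0 opprD addrA subrr add0r.
rewrite -res_E_star mulNmx mulmx_suml big1 ?oppr0 // => i le_i.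
apply: IHk; rewrite col_of_act tpermV tpermR -ltnS -hE.
move: le_i; rewrite leqNgt -ltn_col_height //; lia.
Qed.

(** The test vector is a polytabloid with the last point at the lowest corner; the other corners,
    from bottom to top, form the chain. *)
Lemma minpoly_res :
  minpoly_mx A = \prod_(r <- corners la) ('X - (c_ r)%:P).
Proof.
have la0 : 0%N \notin la by case/and3P: la_part.
have corners_ne : rev (corners la) != [::].
  rewrite -size_eq0 size_rev size_corners // size_eq0.
  case/and3P: la_part => _ _; case: (la) => // p l _.
  by apply: contraTneq (mem_head p l) => undup0; rewrite -mem_undup undup0.
case def_rs: (rev (corners la)) corners_ne => [//|r rs] _.
have r_corner : r \in corners la by rewrite -mem_rev def_rs mem_head.
move: (r_corner); rewrite mem_filter mem_iota => /andP[lt_r /andP[r_gt0 _]].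
have c_gt0 : (0 < nth 0%N la r.-1)%N by apply: leq_ltn_trans lt_r.
have [|t [rt ct]] := @tableau_with_entry n.+1 la ord_max r.-1 (nth 0%N la r.-1).-1 la_part.
  by rewrite prednK.
have star_corner : corner_entry t ord_max by rewrite /corner_entry rt ct !prednK ?r_corner ?eqxx.
have [k k_rs|xs def_xs xs_corner] := @corner_entries _ _ t rs.
  by rewrite -mem_rev def_rs inE k_rs orbT.
have chain_xs : bottom_chain ord_max (row_of t) (col_of t) xs.
  apply/andP; split; last first.
    apply/allP=> x x_xs; apply/forallP=> i; apply/implyP=> /eqP; apply: corner_entry_bottom => //.
    by move: x_xs; rewrite inE => /predU1P[->|/(allP xs_corner)].
  have := sorted_rev_corners la; rewrite def_rs -def_xs -[r](prednK r_gt0) -rt /=.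
  by rewrite (@path_map _ _ (fun x => (row_of t x).+1) gtn ord_max xs).
have sz : size (corners la) = (size xs).+1.
  by rewrite -size_rev def_rs -def_xs /= size_map.
rewrite -(big_map c_ xpredT (fun c => 'X - c%:P)).
have cB : GRing.comm A B.
  by rewrite res_E_star; apply: comm_mx_sym; rewrite /comm_mx mulmxBl mulmxBr scalar_mxC.
apply: (minpoly_mx_prod (v := specht_vec F t) (a := residue_sum F la) (b := -1) _ cB).
- by rewrite size_map sz.
- by rewrite res_E_star scaleN1r.
- by rewrite oppr_eq0 oner_eq0.
(* No column is higher than [size la], so the kill lemma at that bound applies to every
   polytabloid. *)
- apply: specht_vec_span => // t'; rewrite big_map -(@res_star_kill (size la) t') ?count_size //.
  congr (_ *m _); apply: congr_big => //; apply: eq_in_filter => k.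
  by rewrite mem_filter => ->; rewrite andbT.
- rewrite size_map sz; pose phi := @specht_coord F n.+1 la.
  apply: (@star_powers_independent _ _ _ _ _ _ _ _ _ phi) chain_xs.
  + exact: row_col_inj.
  + by move=> i q _; apply: tableau_columns_closed.
  + exact: specht_coord_act.
  + exact: specht_coord_vec.
Qed.

End Restriction.

(** * Induction *)

Section FreeNode.

Variables (F : fieldType) (N : nat).
Implicit Types (X : {ffun 'I_N.+1 -> nat}).

(* With fresh values a for the row and the column of the last point, this gives
   the node of the shape (la, 1) that the column stabilizer fixes. *)
Definition extend_last (f : 'I_N -> nat) a (i : 'I_N.+1) : nat := oapp f a (unlift ord_max i).

Lemma extend_last_lift f a j : extend_last f a (lift ord_max j) = f j.
Proof. by rewrite /extend_last liftK. Qed.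

Lemma extend_last_max f a : extend_last f a ord_max = a.
Proof. by rewrite /extend_last unlift_none. Qed.

Definition forget_last X : {ffun 'I_N -> nat} := [ffun j => X (lift ord_max j)].

Lemma sym_incl_inj : injective (sym_incl N).
Proof.
move=> s s' /permP eq_s; apply/permP=> i; apply: (@lift_inj _ ord_max).
by have := eq_s (lift ord_max i); rewrite /= !lift_perm_lift.
Qed.

Lemma fix_last_sym_incl (s : 'S_N.+1) : s ord_max = ord_max -> exists s', s = sym_incl N s'.
Proof.
move=> s_max; have s_lift j : s (lift ord_max j) != ord_max.
  by rewrite -{2}s_max (inj_eq perm_inj) eq_sym neq_lift.
pose f j := odflt j (unlift ord_max (s (lift ord_max j))).
have fE j : lift ord_max (f j) = s (lift ord_max j).
  by rewrite /f; case: unliftP (s_lift j) => [k -> //|->]; rewrite eqxx.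
have f_inj : injective f.
  by move=> i j /(congr1 (lift ord_max)); rewrite !fE => /perm_inj/lift_inj.
exists (perm f_inj); apply/permP=> i; case: (unliftP ord_max i) => [j ->|->].
  by rewrite /= lift_perm_lift permE fE.
by rewrite /= lift_perm_id.
Qed.

(** The last point is alone in column K, so every column permutation fixes it and comes from the
    smaller group. *)
Lemma poly_coef_extend (rho gam : 'I_N -> nat) R K X : (forall i, gam i != K) ->
  poly_coef F (extend_last rho R) (extend_last gam K) X
    = (X ord_max == R)%:R * poly_coef F rho gam (forget_last X).
Proof.
move=> gamK; rewrite /poly_coef big_distrr /=.
pose P (s : 'S_N.+1) := [forall i, extend_last gam K (s i) == extend_last gam K i].
have PE s : P (sym_incl N s) = [forall i, gam (s i) == gam i].
  apply/forallP/forallP=> [col_s i|col_s i].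
    by have := col_s (lift ord_max i); rewrite /= lift_perm_lift !extend_last_lift.
  case: (unliftP ord_max i) => [j ->|->]; first by rewrite /= lift_perm_lift !extend_last_lift.
  by rewrite /= lift_perm_id.
pose C := [set s' : 'S_N | [forall i, gam (s' i) == gam i]].
transitivity (\sum_(s in [set sym_incl N s' | s' in C])
    ((-1) ^+ s * [forall i, X (s i) == extend_last rho R i]%:R : F)).
  apply: eq_bigl => s; rewrite -/(P s); apply/idP/imsetP => [Ps|[s']]; last first.
    by rewrite inE => col_s' ->; rewrite PE.
  have s_max : s ord_max = ord_max.
    have /forallP/(_ ord_max) := Ps; rewrite extend_last_max.
    by case: (unliftP ord_max (s ord_max)) => // j ->; rewrite extend_last_lift (negPf (gamK j)).
  have [s' def_s] := fix_last_sym_incl s_max; exists s' => //.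
  by rewrite inE -PE -def_s.
rewrite big_imset => [|s s' _ _]; last exact: sym_incl_inj.
apply: eq_big => s /=; first by rewrite inE.
move=> _; rewrite odd_lift_perm addbb /= mulrCA; congr (_ * _); rewrite -natrM mulnb.
congr (_%:R); congr nat_of_bool; apply/forallP/andP => [row_s|[X_max /forallP row_s] i].
  split; first by have := row_s ord_max; rewrite lift_perm_id extend_last_max.
  apply/forallP=> i; have := row_s (lift ord_max i).
  by rewrite lift_perm_lift extend_last_lift ffunE.
case: (unliftP ord_max i) => [j ->|->]; last by rewrite lift_perm_id extend_last_max.
by have := row_s j; rewrite lift_perm_lift extend_last_lift ffunE.
Qed.

End FreeNode.

Lemma transpositions_conj k (s g : 'S_k) :
  ((s ^ g)%g \in transpositions k) = (s \in transpositions k).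
Proof.
have sub u h : u \in transpositions k -> (u ^ h)%g \in transpositions k.
  case/imsetP=> -[i j]; rewrite inE /= => ij ->; rewrite tpermJ.
  by apply/imsetP; exists (h i, h j); rewrite ?inE /= ?(inj_eq perm_inj).
by apply/idP/idP => [/(sub _ g^-1%g)|/sub//]; rewrite conjgK.
Qed.

Lemma big_neq_max (V : nmodType) k (f : 'I_k.+1 -> V) :
  \sum_(i | i != ord_max) f i = \sum_j f (lift ord_max j).
Proof.
rewrite (reindex_omap (lift ord_max) (unlift ord_max)) => [|i i_max] /=.
  by apply: eq_bigl => j; rewrite liftK eqxx eq_sym neq_lift.
by case: unliftP i_max => [j ->|->] //; rewrite eqxx.
Qed.

(** * The minimal polynomial on the induced module *)

Section Induced.

Variables (F : fieldType) (n : nat) (la : seq nat).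
Hypothesis la_part : is_partition_of n.+1 la.

Let la_sorted : sorted geq la. Proof. by case/and3P: la_part. Qed.
Local Notation rG := (specht_repr n.+1 la F).
Local Notation rI := (ind_repr (sym_incl n.+1) rG).
Local Notation A := (gring_op rI (E_elt F n.+2)).
Local Notation tens := (tens (sym_incl n.+1) rG).
Local Notation e t := (tens 1%g (specht_vec F t)).
Local Notation star z := (tperm (lift ord_max z) ord_max).
Let B := \sum_(i | i != ord_max) rI (tperm i ord_max).
Let c_ r : F := residue_sum F la + ((nth 0%N la r)%:R - r%:R).
Implicit Types (t : tableau n.+1 la) (y z : 'I_n.+1).

Lemma ind_EE : A = \sum_(s in transpositions n.+2) rI s.
Proof. by rewrite /E_elt /gset_mx linear_sum; apply: eq_bigr => s _; rewrite /= gring_opG ?inE. Qed.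

Lemma ind_E_comm g : comm_mx A (rI g).
Proof.
rewrite /comm_mx ind_EE mulmx_suml mulmx_sumr [RHS](reindex_inj (conjg_inj g)).
apply: eq_big => s; first by rewrite transpositions_conj.
by move=> _; rewrite -!repr_mxM ?inE // conjgC.
Qed.

Lemma ind_E_comm_sum (I : finType) (P : pred I) (g : I -> 'S_n.+2) :
  comm_mx A (\sum_(i | P i) rI (g i)).
Proof. by apply: comm_mx_sum => i _; apply: ind_E_comm. Qed.

(** Transpositions fixing the last point cross the tensor sign when the group component is 1, and
    their sum is a scalar on the Specht module. *)
Lemma ind_vec_E t : e t *m A = e t *m ((residue_sum F la)%:M + 1 *: B).
Proof.
rewrite scale1r ind_EE big_transpositions_last !mulmxDr mul_mx_scalar; congr (_ + _).
rewrite -tensZ -specht_vec_transpositions // !mulmx_sumr tens_sum.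
by apply: eq_bigr => s _; rewrite tens_act tens_mul ?inE // mulg1 mul1g.
Qed.

(** In the symmetric group, [star y] times [star z] is the swap of y and z times [star y]; the swap
    then crosses the tensor sign. *)
Lemma star_starE t y z : y != z ->
  tens (star y) (specht_vec F t) *m rI (star z)
    = tens (star y) (specht_vec F (tableau_act t (tperm y z))).
Proof.
move=> yz; rewrite tens_act -specht_vec_act tens_mul ?inE //; congr (tens _ _).
have -> : sym_incl n.+1 (tperm y z) = tperm (lift ord_max y) (lift ord_max z).
  apply/permP=> i; case: (unliftP ord_max i) => [j ->|->] /=.
    by rewrite lift_perm_lift (inj_tperm _ _ _ (@lift_inj _ _)).
  by rewrite lift_perm_id tpermD // eq_sym neq_lift.
rewrite [RHS]conjgC tpermJ tpermL tpermD ?(inj_eq (@lift_inj _ _)) ?neq_lift //.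
by rewrite [tperm ord_max _]tpermC.
Qed.

Definition col_star t c := \sum_(z | col_of t z == c) rI (star z).

(* Antisymmetrizes e t over column c enlarged by the last point. *)
Definition col_ext t c := e t *m (1%:M - col_star t c).

(** The Garnir relation for y and c, with each swap of y and z turned into a right action of
    [star z] by [star_starE]. *)
Lemma star_garnir t y c :
    col_of t y != c ->
    (forall r, (col_of t y < nth 0%N la r)%N -> (c < nth 0%N la r)%N) ->
  tens (star y) (specht_vec F t) *m (1%:M - col_star t c) = 0.
Proof.
move=> cy taller; apply/eqP; rewrite mulmxBr mulmx1 subr_eq0 mulmx_sumr; apply/eqP.
rewrite -{1}(specht_vec_garnir F cy taller) tens_sum.
apply: eq_bigr => z cz; rewrite star_starE //.
by apply: contraNneq cy => ->.
Qed.

(** On e_t the column star G satisfies (G - 1)(G + h) = 0: repeating a swap gives e_t back, and two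
    different ones give a sign by antisymmetry. *)
Lemma col_star_sq t c :
  e t *m col_star t c *m (1%:M - col_star t c) = - ((col_height la c)%:R *: col_ext t c).
Proof.
rewrite /col_ext; set G := col_star t c; set h := col_height la c.
have eGG : e t *m G *m G = h%:R *: e t - (h%:R - 1) *: (e t *m G).
  transitivity (\sum_(y | col_of t y == c) (e t - (h%:R - 1) *: tens (star y) (specht_vec F t))).
    rewrite [e t *m G]mulmx_sumr mulmx_suml; apply: eq_bigr => y cy.
    rewrite tens_act mul1g /G /col_star mulmx_sumr (bigD1 y) //= tens_act.
    rewrite -{2}tpermV mulgV; congr (_ + _).
    transitivity (\sum_(z | (col_of t z == c) && (z != y)) - tens (star y) (specht_vec F t)).
      apply: eq_bigr => z /andP[cz zy]; rewrite star_starE 1?eq_sym //.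
      rewrite specht_vec_same_col 1?eq_sym // ?(eqP cy) ?(eqP cz) //.
      by rewrite tensN.
    rewrite sumr_const -scaler_nat scalerN; congr (- (_ *: _)).
    apply/eqP; rewrite eq_sym subr_eq natr1.
    rewrite -[h](card_col_of la_sorted t) [in X in X == _](cardD1 y) inE cy add1n.
    by apply/eqP; congr (_.+1%:R); apply: eq_card => z; rewrite !inE andbC.
  rewrite sumrB sumr_const -scaler_sumr -scaler_nat (card_col_of la_sorted t); congr (_ - _ *: _).
  by rewrite /G /col_star mulmx_sumr; apply: eq_bigr => y _; rewrite tens_act mul1g.
rewrite mulmxBr mulmx1 eGG mulmxBr mulmx1 scalerBr scalerBl scale1r.
by rewrite !opprB addrA [e t *m G + _]addrC subrK.
Qed.

(** As A is central, it can act on e_t before the antisymmetrization. Then columns right of c vanish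
    by Garnir, c itself contributes minus its height, and each column left of c contributes 1 and a
    correction. *)
Lemma col_ext_E t c : (c <= nth 0%N la 0)%N ->
  col_ext t c *m (A - (residue_sum F la + (c%:R - (col_height la c)%:R))%:M)
    = - \sum_(c' < c) col_ext t c' *m (1%:M - col_star t c).
Proof.
move=> le_c; set K := nth 0%N la 0.
have colK z : (col_of t z < K)%N by apply: leq_trans (col_of_lt t z) (leq_part la_sorted (leq0n _)).
have eB : e t *m B = \sum_(c' < K) e t *m col_star t c'.
  rewrite /B big_neq_max -mulmx_sumr; congr (_ *m _).
  rewrite -(big_fiber xpredT (col_of t) K).
  by apply: eq_bigl => z; rewrite colK.
have cA : comm_mx A (1%:M - col_star t c).
  apply: comm_mxB; first exact: comm_mx1.
  exact: ind_E_comm_sum.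
rewrite mulmxBr mul_mx_scalar {1}/col_ext -mulmxA -cA mulmxA ind_vec_E scale1r.
rewrite [e t *m (_ + _)]mulmxDr mul_mx_scalar mulmxDl -scalemxAl.
rewrite -/(col_ext t c) scalerDl opprD addrACA subrr add0r eB mulmx_suml.
pose f c' := e t *m col_star t c' *m (1%:M - col_star t c).
have f_lt c' : (c' < c)%N -> f c' = col_ext t c - col_ext t c' *m (1%:M - col_star t c).
  move=> _; rewrite /f /col_ext -mulmxBl [e t *m (_ - col_star t c')]mulmxBr mulmx1.
  by rewrite opprB [e t + _]addrC subrK.
have f_gt c' : (c < c')%N -> f c' = 0.
  move=> gt_c; rewrite /f mulmx_sumr mulmx_suml big1 // => y /eqP cy.
  by rewrite tens_act mul1g; apply: star_garnir => [|r]; rewrite cy ?gtn_eqF //; apply: ltn_trans.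
have fc : f c = - ((col_height la c)%:R *: col_ext t c) by apply: col_star_sq.
(* Column K is empty; including it in the sum covers the case c = K. *)
have fK : f K = 0.
  by rewrite /f /col_star big_pred0 ?mulmx0 ?mul0mx // => z; rewrite ltn_eqF.
have -> : \sum_(c' < K) f c' = \sum_(c' < c) f c' + f c.
  transitivity (\sum_(c' < K.+1) f c'); first by rewrite big_ord_recr /= fK addr0.
  transitivity (\sum_(c' < c.+1) f c'); last by rewrite big_ord_recr.
  rewrite [RHS](@big_ord_widen _ _ _ c.+1 K.+1) // [RHS]big_mkcond; apply: eq_bigr => c' _.
  by case: ltnP => // /f_gt.
rewrite fc (eq_bigr (fun c' : 'I_c => col_ext t c - col_ext t c' *m (1%:M - col_star t c))).
  rewrite sumrB sumr_const card_ord -scaler_nat scalerBl opprB addrA subrK.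
  by rewrite addrAC subrr add0r.
by move=> c' _; apply: f_lt.
Qed.

(** Downward induction on k: the factors for rows above k already kill the extensions over columns
    higher than k, so only columns of height exactly k need the new factor. *)
Lemma ind_kill j k t c :
    (k + j = (size la).+1)%N -> (c <= nth 0%N la 0)%N -> (k <= col_height la c)%N ->
  col_ext t c *m (\prod_(r <- [seq r <- iota k j | r \in 0%N :: corners la]) (A - (c_ r)%:M)) = 0.
Proof.
elim: j k t c => [|j IHj] k t c.
  rewrite addn0 => -> _ /leq_trans/(_ (count_size _ _)).
  by rewrite ltnn.
rewrite addnS => /succn_inj kj le_c le_h.
have {}IHj t' c' := IHj k.+1 t' c' (congr1 S kj).
rewrite /=; set L := [seq _ <- _ | _] in IHj *.
set Pi := \prod_(r <- L) _ in IHj *.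
have cPi g : comm_mx A g -> comm_mx g Pi.
  by move=> cAg; rewrite /Pi -(big_map c_ xpredT (fun c => A - c%:M)); apply: prod_subC_comm.
have cStar t' c' : comm_mx A (1%:M - col_star t' c').
  by apply: comm_mxB; [apply: comm_mx1 | apply: ind_E_comm_sum].
have cAA : comm_mx A (A - (c_ k)%:M).
  by apply: comm_mx_sym; rewrite /comm_mx mulmxBl mulmxBr scalar_mxC.
have [lt_h|ge_h] := ltnP k (col_height la c).
  case: ifP => _; last exact: IHj.
  by rewrite big_cons -/Pi -mulmxE (cPi _ cAA) mulmxA IHj // mul0mx.
have {le_h ge_h} hE : col_height la c = k by apply/eqP; rewrite eqn_leq le_h ge_h.
(* The leftmost column of height k; all columns before it are higher. *)
set c0 := nth 0%N la k.
have le_c0 : (c0 <= c)%N by rewrite leqNgt -ltn_col_height // hE ltnn.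
have lt_prev : (0 < k)%N -> (c < nth 0%N la k.-1)%N.
  by move=> k_gt0; rewrite -ltn_col_height // hE prednK.
have hE0 : col_height la c0 = k.
  apply/eqP; rewrite eqn_leq leqNgt ltn_col_height // ltnn /=.
  have [->//|k_gt0] := posnP k; rewrite -[X in (X <= _)%N](prednK k_gt0) ltn_col_height //.
  exact: leq_ltn_trans (lt_prev k_gt0).
have k_corner : k \in 0%N :: corners la.
  have [->|k_gt0] := posnP k; first exact: mem_head.
  rewrite inE mem_filter mem_iota k_gt0 add1n ltnS -[X in (X <= size la)%N]hE count_size.
  by rewrite (leq_ltn_trans le_c0 (lt_prev k_gt0)) orbT.
rewrite k_corner big_cons -/Pi -mulmxE.
have kill0 : col_ext t c0 *m ((A - (c_ k)%:M) *m Pi) = 0.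
  rewrite mulmxA /c_ -hE0 -/c0 {1}hE0 -/c0 col_ext_E ?(leq_trans le_c0) //.
  rewrite mulNmx mulmx_suml big1 ?oppr0 // => c' _.
  rewrite -mulmxA (cPi _ (cStar t c0)) mulmxA IHj ?mul0mx //.
    by apply: leq_trans (ltnW (ltn_ord c')) (leq_trans le_c0 le_c).
  by rewrite ltn_col_height.
move: le_c0; rewrite leq_eqVlt => /predU1P[<- //|lt_c0].
(* Columns c0 and c have equal height, so the cross term vanishes by Garnir, and killing the
   extension over c0 suffices. *)
have -> : col_ext t c = col_ext t c0 *m (1%:M - col_star t c).
  rewrite [in RHS]/col_ext [e t *m (_ - col_star t c0)]mulmxBr mulmx1 mulmxBl -/(col_ext t c).
  suff -> : e t *m col_star t c0 *m (1%:M - col_star t c) = 0 by rewrite subr0.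
  rewrite mulmx_sumr mulmx_suml big1 // => y /eqP cy; rewrite tens_act mul1g.
  by rewrite star_garnir // cy ?ltn_eqF // => r; rewrite -!ltn_col_height // hE hE0.
have cGA : comm_mx (1%:M - col_star t c) (A - (c_ k)%:M).
  by apply: comm_mxB; [apply: comm_mx_sym | apply: comm_mx_scalar].
by rewrite -mulmxA (comm_mxM cGA (cPi _ (cStar t c))) mulmxA kill0 mul0mx.
Qed.

(** Over the empty column [nth 0 la 0] the extension is e_t itself; translates of these vectors
    span, and the product is central. *)
Lemma ind_E_kill :
  \prod_(r <- 0%N :: corners la) (A - (c_ r)%:M) = 0.
Proof.
have <- : [seq r <- iota 0 (size la).+1 | r \in 0%N :: corners la] = 0%N :: corners la.
  rewrite /=; congr (_ :: _); apply: eq_in_filter => r.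
  rewrite mem_iota inE mem_filter mem_iota => /andP[r_gt0 ->].
  by rewrite r_gt0 !andbT (gtn_eqF r_gt0).
set Z := \prod_(r <- _) _.
have eZ t : e t *m Z = 0.
  rewrite -[RHS](@ind_kill (size la).+1 0%N t (nth 0%N la 0)) // -/Z; congr (_ *m _).
  rewrite /col_ext /col_star big_pred0 ?subr0 ?mulmx1 // => z.
  by rewrite ltn_eqF //; apply: leq_trans (col_of_lt t z) (leq_part la_sorted (leq0n _)).
have cZ g : comm_mx (rI g) Z.
  by rewrite /Z -(big_map c_ xpredT (fun c => A - c%:M)); apply/prod_subC_comm/ind_E_comm.
apply: tens_span => v g; rewrite tens_mxE -mulmxA.
suff -> : tens_mx (sym_incl n.+1) rG g *m Z = 0 by rewrite mulmx0.
apply: specht_vec_span => // t; rewrite mulmxA -tens_mxE.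
by rewrite -[g]mul1g -tens_act -mulmxA cZ mulmxA eZ mul0mx.
Qed.

(** [tens g v] is viewed as v with the last point at a fresh node in row [size la], then moved by g;
    so X is read back through g. *)
Definition ind_coord_at (X : {ffun 'I_n.+2 -> nat}) (g : 'S_n.+2) :
    'cV[F]_(\rank (specht_mx n.+1 la F)) :=
  (X (g ord_max) == size la)%:R *: specht_coord F la (forget_last (row_act X g)).

Lemma ind_coord_at_mul X h g : rG h *m ind_coord_at X g = ind_coord_at X (sym_incl n.+1 h * g)%g.
Proof.
rewrite /ind_coord_at -scalemxAr specht_coord_act permM /= lift_perm_id.
congr (_ *: specht_coord _ _ _).
by apply/ffunP=> i; rewrite !ffunE permM /= lift_perm_lift.
Qed.

Definition ind_coord X : 'cV[F]_(\rank (cokermx (tensor_rel_mx (sym_incl n.+1) rG))) :=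
  sval (tens_universal (fun h g _ => ind_coord_at_mul X h g)).

Lemma ind_coordE X g v : tens g v *m ind_coord X = v *m ind_coord_at X g.
Proof. exact: (svalP (tens_universal (fun h g _ => ind_coord_at_mul X h g))). Qed.

Lemma ind_coord_act s X : rI s *m ind_coord X = ind_coord (row_act X s).
Proof.
apply/eqP; rewrite -subr_eq0; apply/eqP; apply: tens_span => v g.
rewrite mulmxBr mulmxA tens_act !ind_coordE; apply/eqP; rewrite subr_eq0; apply/eqP.
rewrite /ind_coord_at permM !ffunE; congr (_ *m (_ *: specht_coord _ _ _)).
by apply/ffunP=> i; rewrite !ffunE permM.
Qed.

Lemma ind_coord_vec t X :
  e t *m ind_coord X = (poly_coef F (extend_last (row_of t) (size la))
                                    (extend_last (col_of t) (nth 0%N la 0)) X)%:M.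
Proof.
rewrite ind_coordE /ind_coord_at perm1 -scalemxAr specht_coord_vec poly_coef_extend.
  rewrite scale_scalar_mx; congr (_ * poly_coef _ _ _ _)%:M.
  by apply/ffunP=> i; rewrite !ffunE perm1.
by move=> i; rewrite ltn_eqF //; apply: leq_trans (col_of_lt t i) (leq_part la_sorted (leq0n _)).
Qed.

(** The last point starts at the fresh node, so all the corners enter the chain and one more root
    appears than for the restriction. *)
Lemma minpoly_ind :
  minpoly_mx A = \prod_(r <- 0%N :: corners la) ('X - (c_ r)%:P).
Proof.
have [t _] : exists t : tableau n.+1 la, row_of t ord_max = 0%N /\ col_of t ord_max = 0%N.
  apply: tableau_with_entry => //; case/and3P: la_part => _.
  by case: (la) => //= p l; rewrite inE negb_or eq_sym lt0n => /andP[].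
have [k|xs def_xs xs_corner] := @corner_entries _ _ t (rev (corners la)); first by rewrite mem_rev.
have lt_row z : (row_of t z < size la)%N.
  by rewrite ltnNge; apply: contraL (col_of_lt t z) => /(nth_default 0%N)->.
have lt_col z : (col_of t z < nth 0%N la 0)%N.
  exact: leq_trans (col_of_lt t z) (leq_part la_sorted (leq0n _)).
pose rho := extend_last (row_of t) (size la).
pose gam := extend_last (col_of t) (nth 0%N la 0).
pose ys : seq 'I_n.+2 := map (lift ord_max) xs.
have chain_ys : bottom_chain ord_max rho gam ys.
  apply/andP; split; last first.
    apply/allP=> x x_ys; apply/forallP=> i; apply/implyP; move: x_ys; rewrite inE.
    case/predU1P=> [->|/mapP[j j_xs ->]]; case: (unliftP ord_max i) => [k ->|->] //;
      rewrite /rho /gam ?extend_last_lift ?extend_last_max ?(ltn_eqF (lt_col _))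
              ?(gtn_eqF (lt_col _)) //.
    by move/eqP; apply: corner_entry_bottom => //; apply: (allP xs_corner).
  have : sorted (fun x y : 'I_n.+2 => rho y < rho x)%N ys.
    rewrite sorted_map; have := sorted_rev_corners la; rewrite -def_xs sorted_map.
    by apply: sub_sorted => x y; rewrite /= /rho !extend_last_lift.
  rewrite /ys; case: (xs) => //= x xs' ->.
  by rewrite /rho extend_last_lift extend_last_max lt_row.
have sz : size (0%N :: corners la) = (size ys).+1.
  by rewrite /= /ys size_map -size_rev -def_xs size_map.
rewrite -(big_map c_ xpredT (fun c => 'X - c%:P)).
apply: (minpoly_mx_prod (v := e t) (a := residue_sum F la) (b := 1) _ _ (ind_vec_E t)).
- by rewrite size_map.
- exact: ind_E_comm_sum.
- exact: oner_neq0.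
- by rewrite big_map ind_E_kill.
- rewrite size_map sz; apply: (@star_powers_independent _ _ _ _ _ _ _ _ _ ind_coord) chain_ys.
  + move=> i j; rewrite /rho /gam.
    case: (unliftP ord_max i) => [k ->|->]; case: (unliftP ord_max j) => [l ->|->] //;
      rewrite ?extend_last_lift ?extend_last_max.
    * by move=> rkl ckl; rewrite (row_col_inj rkl ckl).
    * by move=> rk; have := lt_row k; rewrite rk ltnn.
    * by move=> rl; have := lt_row l; rewrite -rl ltnn.
  + move=> i q; case: (unliftP ord_max i) => [k -> _|->]; last by rewrite eqxx.
    rewrite /rho /gam !extend_last_lift => /(tableau_columns_closed la_sorted)[z cz rz].
    by exists (lift ord_max z); rewrite extend_last_lift.
  + exact: ind_coord_act.
  + exact: ind_coord_vec.
Qed.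

End Induced.

Theorem theorem2p7 (F : fieldType) (n m : nat) (la : seq nat)
    (la_part : is_partition_of n.+1 la) (la_m : size (undup la) = m) :
  minpoly_mx (gring_op (res_repr (specht_repr n.+1 la F)) (E_elt F n))
    = \prod_(1 <= u < m.+1) ('X - (residue_sum F (part_down la u))%:P)
  /\
  minpoly_mx (gring_op (ind_repr (sym_incl n.+1) (specht_repr n.+1 la F))
                       (E_elt F n.+2))
    = \prod_(1 <= u < m.+2) ('X - (residue_sum F (part_up la u))%:P).
Proof.
have [la_sorted la0 _] := and3P la_part.
have szc : size (corners la) = m by rewrite size_corners.
split.
  (* [corner_row la u] is entry u of [0 :: corners la]. From u = 1 on, this gives [corners la] in
     the first formula; the second uses u - 1 and gives the whole list. *)
  rewrite minpoly_res // big_add1 (big_nth 0%N) szc !big_mkord; apply: eq_bigr => u _.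
  rewrite -residue_sum_corner //.
  by apply: mem_nth; rewrite szc.
rewrite minpoly_ind // big_add1 (big_nth 0%N) /= szc !big_mkord.
by apply: eq_bigr => u _; rewrite residue_sum_part_up.
Qed.
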